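(* Let $B_n$ be any polyomino chain having $n\geq 3$ squares and $s$ segment(s) $S_1,S_2,\dots,S_s$ with length vector $l=(l_1,l_2,\dots,l_s)$ and structural vector $\tau=(\tau_1,\tau_2,\dots,\tau_s)$ (and with the numbers $\alpha_i$, $\beta_i$ determined by $l$). Then $$\begin{aligned}TI(B_n)={}&3n\theta_{3,3}+(2\theta_{2,3}-6\theta_{3,3}+4\theta_{3,4})s+(2\theta_{2,2}+2\theta_{2,3}+\theta_{3,3}-4\theta_{3,4})\\&+(\theta_{2,4}-\theta_{2,3}+\theta_{3,3}-\theta_{3,4})[\beta_1+\beta_s]+(\theta_{3,3}-2\theta_{3,4}+\theta_{4,4})\sum_{i=1}^{s}\tau_i\\&+(2\theta_{2,4}-2\theta_{2,3}+3\theta_{3,3}-4\theta_{3,4}+\theta_{4,4})\sum_{i=1}^{s}\alpha_i.\end{aligned}$$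
   Context: A polyomino system is a finite 2-connected plane graph in which each interior face is a regular (unit) square of side length one. Two squares are adjacent if they share an edge. A polyomino chain is a polyomino system in which every square is adjacent to at most two squares; its squares form a sequence $C_1,\dots,C_n$ in which exactly consecutive squares are adjacent. A square adjacent to only one other square is terminal; a square adjacent to two other squares is non-terminal. A kink is a non-terminal square having a vertex of degree 2 (degrees are taken in the graph of the chain). A linear chain is a polyomino chain without kinks. A segment is a maximal linear chain in a polyomino chain, including the kinks and/or terminal squares at its ends; its length $l(S)$ is its number of squares. A polyomino chain with $n$ squares consists of a sequence of segments $S_1,\dots,S_s$, listed in order along the chain, consecutive ones sharing exactly one square (a kink), with lengths $l_i=l(S_i)$ and $\sum_{i=1}^s l_i=n+s-1$. The segments $S_1,S_s$ are external, and $S_i$ with $2\le i\le s-1$ are internal. The length vector is $(l_1,\dots,l_s)$. For $2\le i\le s-1$: $\alpha_i=1$ if $l_i=2$ and $\alpha_i=0$ if $l_i\ge 3$; and $\alpha_1=\alpha_s=0$. For $1\le j\le s$: $\beta_j=1$ if $l_j=2$ and $\beta_j=0$ if $l_j\geq 3$. For $1\le i\le s$: $\tau_i=1$ if $S_i$ is an internal segment with $l_i=3$ containing an edge connecting two vertices of degree 3, and $\tau_i=0$ otherwise. Bond incident degree (BID) index: given a symmetric non-negative real valued function $f$, with $\theta_{a,b}=f(a,b)$, put $TI(G)=\sum_{uv\in E(G)}f(d_u,d_v)=\sum_{1\le a\le b\le\Delta(G)}x_{a,b}(G)\,\theta_{a,b}$, where $d_u$ is the degree of the vertex $u$, $\Delta(G)$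 is the maximum degree, and $x_{a,b}(G)$ is the number of edges of $G$ connecting a vertex of degree $a$ with a vertex of degree $b$. *)

(* Defs.v *)
From HB Require Import structures.
From mathcomp Require Import all_boot all_order all_algebra.
From mathcomp Require Import finmap.
From mathcomp Require Import reals.

Set Implicit Arguments.
Unset Strict Implicit.
Unset Printing Implicit Defensive.

Import Order.TTheory GRing.Theory Num.Theory.

Local Open Scope ring_scope.

(* Edge-to-edge unit squares forming a connected figure in the plane lie on a
   common square lattice, so plane graphs are drawn on Z^2: vertices are
   lattice points, edges are unit lattice segments. *)
Definition point := (int * int)%type.

(* The cell (x, y) is the closed square [x, x+1] x [y, y+1]. *)
Definition cell := (int * int)%type.

(* ((x, y), false) is the segment from (x, y) to (x+1, y), and
   ((x, y), true) the segment from (x, y) to (x, y+1); every unit lattice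
   segment is thus represented exactly once. *)
Definition gedge := (point * bool)%type.

Definition src (e : gedge) : point := e.1.

Definition tgt (e : gedge) : point :=
  if e.2 then (e.1.1, e.1.2 + 1) else (e.1.1 + 1, e.1.2).

Definition incident (v : point) (e : gedge) : bool :=
  (v == src e) || (v == tgt e).

Definition sides (c : cell) : seq gedge :=
  [:: (c, false); (c, true);
      ((c.1, c.2 + 1), false); ((c.1 + 1, c.2), true)].

Definition corners (c : cell) : seq point :=
  [:: c; (c.1 + 1, c.2); (c.1, c.2 + 1); (c.1 + 1, c.2 + 1)].

Definition adjacent (c c' : cell) : bool :=
  (c != c') && has (fun e => e \in sides c') (sides c).

(* A graph is given by its edges; its vertices are their endpoints (a
   2-connected graph has no isolated vertex). *)
Definition graph := {fset gedge}.

Definition vertices (E : graph) : {fset point} :=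
  ([fset src e | e in E] `|` [fset tgt e | e in E])%fset.

Definition deg (E : graph) (v : point) : nat :=
  #|` [fset e in E | incident v e]%fset |.

Definition neighbours (E : graph) (u v : point) : bool :=
  (u != v) && has (fun e => incident u e && incident v e) E.

Definition linked (T : eqType) (r : rel T) (x y : T) : Prop :=
  exists2 p : seq T, path r x p & last x p = y.

Definition two_connected (E : graph) : Prop :=
  [/\ (2 < #|` vertices E |)%N,
      forall u v, u \in vertices E -> v \in vertices E ->
        linked (neighbours E) u v
    & forall w u v, w \in vertices E -> u \in vertices E ->
        v \in vertices E -> u != w -> v != w ->
        linked (fun a b => [&& neighbours E a b, a != w & b != w]) u v].

(* Faces are the connected components of the plane minus the drawing.  Every
   face is open, hence meets the interior of some cell, and two cell interiors
   lie in the same face iff one can go from one to the other by crossing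
   lattice segments which are not edges of the graph. *)
Definition crossable (E : graph) (c c' : cell) : bool :=
  (c != c') && has (fun e => (e \in sides c') && (e \notin E)) (sides c).

Definition same_face (E : graph) (c c' : cell) : Prop :=
  linked (crossable E) c c'.

(* The face containing the interior of c is bounded, i.e., interior. *)
Definition in_interior_face (E : graph) (c : cell) : Prop :=
  exists m : int, forall c', same_face E c c' -> `|c'.1| <= m /\ `|c'.2| <= m.

Definition polyomino_system (E : graph) : Prop :=
  two_connected E /\
  forall c, in_interior_face E c -> forall c', same_face E c c' -> c' = c.

(* cs lists the squares C_1, ..., C_n of E along the chain. *)
Definition polyomino_chain (E : graph) (cs : seq cell) : Prop :=
  [/\ polyomino_system E,
      uniq cs,
      forall c, c \in cs <-> in_interior_face E c
    & forall i j, (i < size cs)%N -> (j < size cs)%N ->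
        adjacent (nth (0, 0) cs i) (nth (0, 0) cs j)
          = (j == i.+1) || (i == j.+1)].

Definition nonterminal (cs : seq cell) (c : cell) : bool :=
  (c \in cs) && (count (adjacent c) cs == 2%N).

Definition kink (E : graph) (cs : seq cell) (c : cell) : bool :=
  nonterminal cs c && has (fun v => deg E v == 2%N) (corners c).

Definition linear_chain (E : graph) (cs : seq cell) : Prop :=
  polyomino_chain E cs /\ forall c, ~~ kink E cs c.

Definition all_sides (t : seq cell) : seq gedge := flatten (map sides t).

Definition graph_of (t : seq cell) : graph := [fset e in all_sides t]%fset.

(* The subchains of C_1, ..., C_n are its blocks of consecutive squares; such a
   block is linear as a chain of its own, so a kink of the whole chain may
   occur as an end of it. *)
Definition linear_subchain (cs t : seq cell) : Prop :=
  infix t cs /\ linear_chain (graph_of t) t.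

Definition segment (cs t : seq cell) : Prop :=
  linear_subchain cs t /\
  forall t', linear_subchain cs t' -> infix t t' -> t' = t.

(* S lists all the segments of cs, once each, in order along the chain. *)
Definition segments (cs : seq cell) (S : seq (seq cell)) : Prop :=
  (forall t, t \in S <-> segment cs t) /\
  sorted ltn [seq index (head (0, 0) t) cs | t <- S].

Definition length_vector (S : seq (seq cell)) : seq nat := map size S.

(* Indices below are shifted by one: index i stands for the segment S_(i+1),
   and l is the length vector. *)
Definition internal (s i : nat) : bool := (0 < i)%N && (i.+1 < s)%N.

Definition alpha (l : seq nat) (i : nat) : nat :=
  internal (size l) i && (nth 0%N l i == 2%N).

Definition beta (l : seq nat) (i : nat) : nat := nth 0%N l i == 2%N.

Definition tau (E : graph) (S : seq (seq cell)) (i : nat) : nat :=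
  let t := nth [::] S i in
  [&& internal (size S) i, size t == 3%N
    & has (fun e => (deg E (src e) == 3%N) && (deg E (tgt e) == 3%N))
          (all_sides t)].

Definition TI (R : realType) (f : nat -> nat -> R) (E : graph) : R :=
  \sum_(e <- E) f (deg E (src e)) (deg E (tgt e)).

(* Main.v *)
Require Import Defs.
From mathcomp Require Import all_boot all_order all_algebra.
From mathcomp Require Import finmap.
From mathcomp Require Import reals.
From mathcomp Require Import boolp zify ring.

Set Implicit Arguments.
Unset Strict Implicit.
Unset Printing Implicit Defensive.

Import Order.TTheory GRing.Theory Num.Theory.

Local Open Scope ring_scope.

(** Walk along the chain: each square is reached from the previous one by a unit
    step in one of four directions.  A non-terminal square is a kink exactly when
    the step leaving it differs from the step entering it, and a kink turns either
    left or right ([kink_turning]).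

    Every edge is a side of a square of the chain ([system_graph_of]), so the
    degree of a vertex is determined by those of the four lattice squares around
    it which belong to the chain.  Each end of the side shared by two consecutive
    squares has degree 3, or 4 when one of these two squares turns around it
    ([deg_left], [deg_right]); the outer corner of a kink and the four extreme
    corners of the chain have degree 2.  Charge every edge to the last square
    which has it as a side.  What a square is charged depends only on the turns at
    itself and at its two neighbours ([owned_middle]), and since two
    consecutive kinks turn in opposite directions it is a polynomial in the 0-1
    indicators of these turns.  Summation ([TI_by_turns]) expresses the index
    through the number of kinks, the number of pairs of consecutive kinks, the
    number of straight squares between two kinks which turn the same way, and
    whether the second and the last but one squares are kinks.

    The segments are the blocks of squares between consecutive terms of the list
    made of 0, the positions of the kinks, counted from 0, and n - 1
    ([segments_cuts]).  Hence s is
    one more than the number of kinks, a segment of length 2 is a pair of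
    consecutive squares at which the chain turns or ends, and a segment with
    tau = 1 is a straight square between two kinks which turn the same way
    ([tau_segment]): every side of a kink contains its inner corner, of degree 4,
    or its outer corner, of degree 2, so only a side of the middle square can join
    two vertices of degree 3.  This turns the counts above into the sums of alpha,
    beta and tau.

    Two facts about the plane are behind the degrees.  First, no edge lies off the
    squares of the chain.  Second, two squares of the chain which meet in a single
    vertex have a common neighbour in the chain at that vertex
    ([no_corner_contact]).  If one of them failed, a closed curve
    running in the exterior face, except near one vertex v, would separate two
    edges at v, and v would be a cut vertex ([cut_vertex]).  The part of the
    Jordan curve theorem used here is provided by a function on the lattice
    points, the parity of the number of times the curve crosses a horizontal ray
    ([face_potential]). *)

(** * Lattice geometry by directions *)

(** The pair of vertical and backward flags: (false, false) is east,
    (true, false) north, (false, true) west and (true, true) south. *)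
Definition dir := (bool * bool)%type.
Definition lturn (d : dir) : dir := (~~ d.1, d.2 (+) d.1).
Definition back (d : dir) : dir := (d.1, ~~ d.2).
Definition rturn (d : dir) : dir := back (lturn d).

Definition move (c : cell) (d : dir) : cell :=
  let k : int := if d.2 then -1 else 1 in
  if d.1 then (c.1, c.2 + k) else (c.1 + k, c.2).

(** A south or west side starts at the lower left corner of the cell, while a
    north or east side is the south or west side of the next cell. *)
Definition side (c : cell) (d : dir) : gedge :=
  if d.2 then (c, ~~ d.1) else (move c d, ~~ d.1).

(** The left end of the side of [c] in direction [d], seen from the centre
    of [c]; its right end is [corner c (rturn d)]. *)
Definition corner (c : cell) (d : dir) : point :=
  (if d.1 (+) d.2 then c.1 else c.1 + 1, if d.2 then c.2 else c.2 + 1).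

Ltac coords := rewrite /adjacent /incident /src /tgt /side /corner /move /rturn /lturn /back /=
   ?inE ?xpair_eqE /=.

Lemma moveK c d : move (move c d) (back d) = c.
Proof. case: c d => x y [[] []]; coords; congr pair; lia. Qed.

Lemma moveC c d d' : move (move c d) d' = move (move c d') d.
Proof. case: c d d' => x y [[] []] [[] []]; coords; congr pair; lia. Qed.

Lemma move_inj c : injective (move c).
Proof. move=> [[] []] [[] []] //; coords => -[]; lia. Qed.

Lemma move_neq c d : (move c d == c) = false.
Proof. case: c d => x y [[] []]; coords; lia. Qed.

Lemma side_move c d : side (move c d) (back d) = side c d.
Proof. by case: c d => x y [[] []]; coords; congr (_, _, _); lia. Qed.

Lemma mem_side c d c' : (side c d \in sides c') = (c' == c) || (c' == move c d).
Proof. case: c c' d => x y [x' y'] [[] []]; rewrite /sides; coords; lia. Qed.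

Lemma sidesP e c : reflect (exists d, e = side c d) (e \in sides c).
Proof.
apply: (iffP idP) => [|[d ->]]; last by rewrite mem_side eqxx.
rewrite /sides !inE => /or4P[] /eqP->; [exists (true, true)|exists (false, true)|
  exists (true, false)|exists (false, false)] => //.
Qed.

Lemma side_inj c : injective (side c).
Proof. by case: c => x y [[] []] [[] []] //; coords => -[]; lia. Qed.

Lemma perm_sides c : perm_eq (sides c) [seq side c d | d : dir].
Proof.
apply: uniq_perm.
- case: c => x y; rewrite /sides; coords. lia.
- by rewrite map_inj_uniq ?enum_uniq //; apply: side_inj.
- move=> e; apply/sidesP/mapP => [[d ->]|[d _ ->]]; exists d => //.
  by rewrite mem_enum.
Qed.

Lemma shared_side e c c' : e \in sides c -> e \in sides c' -> c != c' ->
  exists2 d, c' = move c d & e = side c d.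
Proof.
move=> /sidesP[d ->]; rewrite mem_side => /orP[] /eqP-> ; first by rewrite eqxx.
by exists d.
Qed.

Lemma adjacentP c c' : reflect (exists d, c' = move c d) (adjacent c c').
Proof.
apply: (iffP andP) => [[cc' /hasP[e ec ec']]|[d ->]].
  by have [d ? _] := shared_side ec ec' cc'; exists d.
split; first by rewrite eq_sym move_neq.
by apply/hasP; exists (side c d); rewrite mem_side eqxx ?orbT.
Qed.

Lemma crossableP E c c' :
  reflect (exists2 d, c' = move c d & side c d \notin E) (crossable E c c').
Proof.
apply: (iffP andP) => [[cc' /hasP[e ec /andP[ec' eE]]]|[d -> dE]].
  by have [d ? eq_e] := shared_side ec ec' cc'; exists d; rewrite -?eq_e.
split; first by rewrite eq_sym move_neq.
by apply/hasP; exists (side c d); rewrite ?mem_side eqxx ?orbT.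
Qed.

Lemma side_edge_ex (e : gedge) : exists c d, e = side c d.
Proof. by case: e => c v; exists c, (~~ v, true); rewrite /side /= negbK. Qed.

(** The same corner seen from across the side, where left and right are exchanged;
    so statements on right ends reduce to statements on left ends. *)
Lemma corner_rturn c d : corner c (rturn d) = corner (move c d) (back d).
Proof. case: c d => x y [[] []]; coords; congr pair; lia. Qed.

Lemma corner_side c d v :
  incident v (side c d) = (v == corner c d) || (v == corner c (rturn d)).
Proof. case: c v d => x y [x' y'] [[] []]; coords; lia. Qed.

Lemma mem_corners c v : (v \in corners c) = [exists d, v == corner c d].
Proof.
apply/idP/existsP => [|[d /eqP->]]; last first.
  case: c d => x y [[] []]; rewrite /corners; coords; lia.
rewrite /corners !inE => /or4P[] /eqP->; [exists (false, true)|exists (true, true)|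
  exists (true, false)|exists (false, false)] => //; case: c => x y; coords; lia.
Qed.

Lemma incident_corner c d e : incident (corner c d) e =
  (e \in [:: side c d; side c (lturn d); side (move (move c d) (lturn d)) (back d);
             side (move (move c d) (lturn d)) (back (lturn d))]).
Proof. case: c e d => x y [[x' y'] []] [[] []]; coords; lia. Qed.

Lemma uniq_star c d : uniq [:: side c d; side c (lturn d); side (move (move c d) (lturn d)) (back d);
             side (move (move c d) (lturn d)) (back (lturn d))].
Proof. case: c d => x y [[] []]; coords; lia. Qed.

(** * Faces and cut vertices *)

Section Linked.
Variables (T : eqType) (r : rel T).

Lemma linked_refl x : linked r x x. Proof. by exists [::]. Qed.

Lemma linked_step x y z : r x y -> linked r y z -> linked r x z.
Proof. by move=> xy [p yp <-]; exists (y :: p); rewrite //= xy. Qed.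

Lemma linked1 x y : r x y -> linked r x y.
Proof. by move=> /linked_step; apply; apply: linked_refl. Qed.

Lemma linked_trans x y z : linked r x y -> linked r y z -> linked r x z.
Proof.
move=> [p xp <-] [q yq <-]; exists (p ++ q); last by rewrite last_cat.
by rewrite cat_path xp.
Qed.

Lemma linked_ind_l (P : T -> T -> Prop) : (forall x, P x x) ->
  (forall x y z, r x y -> P y z -> P x z) -> forall x y, linked r x y -> P x y.
Proof.
move=> P0 PS x y [p]; elim: p x => [|z p IH] x /=; first by move=> _ <-.
by move=> /andP[xz zp] Ey; apply: (PS _ z) => //; apply: IH.
Qed.

Lemma linked_sym : symmetric r -> forall x y, linked r x y -> linked r y x.
Proof.
move=> rs; apply: linked_ind_l => [x|x y z xy zy]; first exact: linked_refl.
by apply: linked_trans zy (linked1 _); rewrite rs.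
Qed.

Lemma linked_const (S : eqType) (W : T -> S) : (forall x y, r x y -> W x = W y) ->
  forall x y, linked r x y -> W x = W y.
Proof. by move=> Wr; apply: linked_ind_l => // x y z /Wr ->. Qed.

End Linked.

Lemma linked_mono (T : eqType) (r r' : rel T) : subrel r r' ->
  forall x y, linked r x y -> linked r' x y.
Proof.
move=> rr'; apply: linked_ind_l => [x|x y z /rr']; first exact: linked_refl.
exact: linked_step.
Qed.

Lemma neighbours_sym E : symmetric (neighbours E).
Proof.
by move=> u v; rewrite /neighbours eq_sym; congr andb; apply: eq_has => e; rewrite andbC.
Qed.

Lemma crossable_sym E : symmetric (crossable E).
Proof.
move=> c c'; rewrite /crossable eq_sym; congr andb.
by apply/hasP/hasP => -[e e1 /andP[e2 e3]]; exists e; rewrite // e1.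
Qed.

Lemma neighboursP (E : graph) u v : reflect (exists e, [/\ e \in E, incident u e, incident v e & u != v])
  (neighbours E u v).
Proof.
apply: (iffP andP) => [[uv /hasP[e eE /andP[ue ve]]]|[e [eE ue ve uv]]]; first by exists e.
by split=> //; apply/hasP; exists e; rewrite ?ue.
Qed.

Lemma src_neq_tgt e : src e != tgt e.
Proof. by case: e => [[x y] []]; coords; lia. Qed.

Lemma incident_other v e : incident v e ->
  exists w, [/\ w != v, incident w e & forall u, incident u e -> u = v \/ u = w].
Proof.
have st := src_neq_tgt e; rewrite /incident => /orP[] /eqP->.
  by exists (tgt e); rewrite eq_sym eqxx orbT; split=> // u /orP[] /eqP->; [left|right].
by exists (src e); rewrite eqxx; split=> // u /orP[] /eqP->; [right|left].
Qed.

Lemma in_vertices E v : reflect (exists2 e, e \in E & incident v e) (v \in vertices E).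
Proof.
rewrite in_fsetU; apply: (iffP orP) => [[]/imfsetP[e /= eE ->]|[e eE /orP[]/eqP->]].
- by exists e; rewrite // /incident eqxx.
- by exists e; rewrite // /incident eqxx orbT.
- by left; apply: in_imfset.
- by right; apply: in_imfset.
Qed.

(** Whether the horizontal edge [e] lies on the ray from [v] to the right; the
    parity of the number of crossings of this ray is the potential used below. *)
Definition on_ray (e : gedge) (v : point) : bool :=
  [&& ~~ e.2, e.1.2 == v.2 & v.1 <= e.1.1].

(** For a vertical edge [g], the cells from [g] on to the right in its row.  Rays
    from the two ends of [g] bound this half-infinite strip. *)
Definition strip (g : gedge) (c : cell) : bool :=
  [&& g.2, c.2 == g.1.2 & g.1.1 <= c.1].

(** A step across one side changes the ray parities at the two ends of [g] alike,
    except when it enters or leaves the strip between the two rays; it does so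
    through a horizontal edge on one of the rays or through [g] itself. *)
Lemma cross_potential c d g :
  (g == side c d) = on_ray (side c d) (src g) (+) on_ray (side c d) (tgt g)
                     (+) (strip g c (+) strip g (move c d)).
Proof. by case: c g d => x y [[x' y'] []] [[] []]; rewrite /on_ray /strip; coords; lia. Qed.

(** The crossing parity of the rays, summed over a path of cells which crosses no
    edge.  Along an edge it changes only on account of the two ends of the path,
    so it is constant along edges when the path is closed. *)
Lemma face_potential E c c' : same_face E c c' -> exists W : point -> bool,
  forall g, g \in E -> W (src g) (+) W (tgt g) = strip g c (+) strip g c'.
Proof.
move: c c'; apply: linked_ind_l => [c|c c1 c2 /crossableP[d -> dE] [W WE]].
  by exists (fun=> false) => g _; rewrite !addbb.
exists (fun v => W v (+) on_ray (side c d) v) => g gE.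
have gd : (g == side c d) = false by apply: contraNF dE => /eqP<-.
have := cross_potential c d g; rewrite gd.
move: (WE g gE).
by case: (W _) (W _) (on_ray _ _) (on_ray _ _) (strip _ _) (strip _ _) (strip _ _)
  => [] [] [] [] [] [] [].
Qed.

(** A closed curve of cells which crosses the graph only in edges at [v] gives a
    potential [W] changing exactly along these edges.  If it crosses one edge at
    [v] but not another, then [W] differs at the other ends of these two edges,
    although it is constant along the paths which avoid [v]. *)
Lemma cut_vertex E (Y : pred gedge) W v g g' : two_connected E ->
  (forall e, e \in E -> W (src e) (+) W (tgt e) = (e \in Y)) ->
  (forall e, e \in Y -> incident v e) ->
  g \in E -> g' \in E -> incident v g -> incident v g' -> g \in Y -> g' \notin Y -> False.
Proof.
move=> [_ _ conn] WE Yv gE g'E vg vg' gY g'Y.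
have WE2 e a b : a != b -> e \in E -> incident a e -> incident b e -> W a (+) W b = (e \in Y).
  move=> ab eE ae be; rewrite -WE //.
  move: ab; case/orP: ae => /eqP->; case/orP: be => /eqP->; rewrite ?eqxx // => _.
  exact: addbC.
(* The other ends [a] and [a'] of the two edges are joined avoiding [v], and no
   edge on that path is crossed since all crossed edges are at [v]. *)
have [a [av ag _]] := incident_other vg; have [a' [a'v a'g' _]] := incident_other vg'.
have /linked_const Waa' : linked (fun x y => [&& neighbours E x y, x != v & y != v]) a a'.
  by apply: conn => //; apply/in_vertices; [exists g|exists g|exists g'].
have {}Waa' : W a = W a'.
  apply: Waa' => x y /and3P[/neighboursP[e [eE xe ye xy]] xv yv].
  have := WE2 e x y xy eE xe ye; rewrite (_ : (e \in Y) = false).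
    by case: (W x) (W y) => [] [].
  apply: contraTF xv => /Yv ve; have [w [_ _ H]] := incident_other ve.
  have [//|xw] := H x xe; first by move=> ->; rewrite eqxx.
  have [yv'|yw] := H y ye; first by rewrite yv' eqxx in yv.
  by move: xy; rewrite xw yw eqxx.
have := WE2 g a v av gE ag vg; have := WE2 g' a' v a'v g'E a'g' vg'.
by rewrite gY (negPf g'Y) Waa'; case: (W a') (W v) => [] [].
Qed.

(** A path from [v] to a third vertex which avoids the other end of [e] leaves
    [v] through another edge. *)
Lemma second_edge E e v : two_connected E -> e \in E -> incident v e ->
  exists g, [/\ g \in E, incident v g & g != e].
Proof.
move=> [cardV _ conn] eE ve; have [a [av ae H]] := incident_other ve.
have vV : v \in vertices E by apply/in_vertices; exists e.
have aV : a \in vertices E by apply/in_vertices; exists e.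
have [w wV /andP[wv wa]] : exists2 w, w \in vertices E & (w != v) && (w != a).
  have /fset0Pn[w] : (vertices E `\` [fset v; a])%fset != fset0.
    rewrite -cardfs_gt0 cardfsD subn_gt0.
    apply: leq_ltn_trans (fsubset_leq_card (fsubsetIr _ _)) _.
    by rewrite cardfs2 eq_sym av.
  by rewrite in_fsetD in_fset2 negb_or => /andP[? ?]; exists w.
have va : v != a by rewrite eq_sym.
have [[|b p] /=] := conn a v w aV vV wV va wa.
  by move=> _ /eqP; rewrite eq_sym (negPf wv).
move=> /andP[/and3P[/neighboursP[g [gE vg bg vb]] _ ba] _] _.
exists g; split=> //; apply: contraNneq ba => ge.
have [|bv|->//] := H b; first by rewrite -ge.
by rewrite bv eqxx in vb.
Qed.

(** * Exterior face and squares of a polyomino system *)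

Definition far (K : int) (c : cell) : bool := (K < `|c.1|) || (K < `|c.2|).

Lemma far_sides (E : graph) : exists K, forall c, far K c -> forall d, side c d \notin E.
Proof.
have [K KE] : exists K : int, forall e, e \in (E : seq gedge) -> `|e.1.1| < K /\ `|e.1.2| < K.
  elim: (E : seq gedge) => [|[[x y] v] s [K IH]]; first by exists 0.
  exists (`|K| + `|x| + `|y| + 1) => [] [[x' y'] v'].
  rewrite inE => /orP[/eqP[-> -> _]|/IH] /=; lia.
exists (`|K|+1) => c farc d; apply/negP => /KE; clear KE.
by case: c d farc => x y [[] []]; rewrite /far; coords; lia.
Qed.

Section Outer.
Variables (E : graph) (K : int).
Hypothesis farK : forall c, far K c -> forall d, side c d \notin E.

Lemma far_step c d : far K c -> crossable E c (move c d).
Proof. by move=> farc; apply/crossableP; exists d; rewrite ?farK. Qed.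

Lemma far_ray c d (n : nat) : (forall i : nat, far K (iter i (move^~ d) c)) ->
  same_face E c (iter n (move^~ d) c).
Proof.
move=> farc; elim: n => [|n IH]; first exact: linked_refl.
by apply: linked_trans IH (linked1 _); apply: far_step.
Qed.

Lemma iter_move n c d : iter n (move^~ d) c =
   if d.1 then (c.1, c.2 + (if d.2 then - n%:Z else n%:Z))
   else (c.1 + (if d.2 then - n%:Z else n%:Z), c.2).
Proof.
elim: n => [|n /= ->]; case: c d => x y [[] []] /=; congr pair; rewrite /=; lia.
Qed.

Lemma far_row x x' y : K < `|y| -> same_face E (x, y) (x', y).
Proof.
move=> Ky.
have -> : (x', y) = iter `|x' - x|%N (move^~ (false, x' < x)) (x, y).
  by rewrite iter_move /=; congr pair; case: ifP; lia.
by apply: far_ray => i; rewrite iter_move /far /= Ky orbT.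
Qed.

Lemma far_column x y y' : K < `|x| -> same_face E (x, y) (x, y').
Proof.
move=> Kx.
have -> : (x, y') = iter `|y' - y|%N (move^~ (true, y' < y)) (x, y).
  by rewrite iter_move /=; congr pair; case: ifP; lia.
by apply: far_ray => i; rewrite iter_move /far /= Kx.
Qed.

(** Outside a bounded square nothing obstructs a horizontal move far from the
    x-axis or a vertical move far from the y-axis, and two such moves reach a
    fixed corner. *)
Lemma far_same_face c c' : far K c -> far K c' -> same_face E c c'.
Proof.
have to_corner a : far K a -> same_face E a (`|K| + 1, `|K| + 1).
  case: a => x y /orP[] /= ?.
    by apply: (@linked_trans _ _ _ (x, `|K| + 1)); [apply: far_column|apply: far_row; lia].
  by apply: (@linked_trans _ _ _ (`|K| + 1, y)); [apply: far_row|apply: far_column; lia].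
move=> /to_corner c1 /to_corner c2; apply: linked_trans c1 _.
by apply: linked_sym c2; apply: crossable_sym.
Qed.

End Outer.

Lemma exteriorP E c : ~ in_interior_face E c <->
  forall m : int, exists2 c', same_face E c c' & far m c'.
Proof.
split=> [nint m|esc [m]].
  apply: contrapT => nex; apply: nint; exists m => c' cc'.
  have : ~~ far m c' by apply/negP => fc'; apply: nex; exists c'.
  by rewrite /far negb_or -!leNgt => /andP.
move=> H; have [c' /H[? ?]] := esc m; rewrite /far; lia.
Qed.

Lemma exterior_same_face E c c' : ~ in_interior_face E c -> ~ in_interior_face E c' ->
  same_face E c c'.
Proof.
have [K farK] := far_sides E => /exteriorP/(_ K)[a ca fa] /exteriorP/(_ K)[a' ca' fa'].
apply: linked_trans ca _; apply: linked_trans (far_same_face farK fa fa') _.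
by apply: linked_sym ca'; apply: crossable_sym.
Qed.

Lemma mem_graph_of t c d : (side c d \in graph_of t) = (c \in t) || (move c d \in t).
Proof.
rewrite in_fset /=; apply/flatten_mapP/orP => [[c' c't]|].
  by rewrite mem_side => /orP[]/eqP<-; [left|right].
by move=> [] ct; [exists c|exists (move c d)] => //; rewrite mem_side eqxx ?orbT.
Qed.

(** A square of the list is a whole face, so its sides are edges.  Conversely an
    edge off the squares would have the exterior face on both sides: the loop
    through this face which crosses the edge once would make an end of the edge a
    cut vertex. *)
Lemma system_graph_of E (cs : seq cell) : polyomino_system E ->
  (forall c, c \in cs <-> in_interior_face E c) -> E = graph_of cs.
Proof.
move=> [conn int1] csE.
have csP c : c \notin cs -> ~ in_interior_face E c by move=> /negP ccs /csE.
apply/fsetP => e; have [c [d ->]] := side_edge_ex e; rewrite mem_graph_of.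
apply/idP/idP => [eE|]; last first.
  have in_E b d' : b \in cs -> side b d' \in E.
    move=> /csE bint; apply/negPn/negP => bd.
    have /(int1 _ bint)/eqP : same_face E b (move b d').
      by apply: linked1; apply/crossableP; exists d'.
    by rewrite move_neq.
  by move=> /orP[/in_E//|m]; rewrite -side_move in_E.
apply/negPn/negP; rewrite negb_or => /andP[/csP ce /csP ce'].
have [W WE] := face_potential (exterior_same_face ce ce').
(* Close up the path from [c] to the cell across the side by crossing that side. *)
pose W' v := W v (+) on_ray (side c d) v.
have W'E g : g \in E -> W' (src g) (+) W' (tgt g) = (g == side c d).
  move=> gE; have := cross_potential c d g; have := WE g gE; rewrite /W'.
  by case: (W _) (W _) (on_ray _ _) (on_ray _ _) (strip _ _) (strip _ _) (_ == _)
    => [] [] [] [] [] [] [].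
have ve : incident (corner c d) (side c d) by rewrite corner_side eqxx.
have [g [gE vg gne]] := second_edge conn eE ve.
apply: (cut_vertex (Y := pred1 (side c d)) conn W'E _ eE gE ve vg) => //=.
- by move=> e' /eqP->.
- by rewrite inE.
Qed.

(** Otherwise the other two cells at the corner lie in the exterior face, and a
    curve joining them in that face closes up through [c], crossing only the two
    sides of [c] at the corner; it separates these from the edges of the
    diagonally opposite square. *)
Lemma no_corner_contact E (cs : seq cell) c d : polyomino_system E ->
  (forall c, c \in cs <-> in_interior_face E c) ->
  c \in cs -> move c d \notin cs -> move c (lturn d) \notin cs ->
  move (move c d) (lturn d) \notin cs.
Proof.
move=> sysE csE ccs pcs qcs; have Ecs := system_graph_of sysE csE.
have [conn int1] := sysE.
have csP c' : c' \notin cs -> ~ in_interior_face E c' by move=> /negP ccs' /csE.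
apply/negP => c'cs; have [W WE] := face_potential (exterior_same_face (csP _ pcs) (csP _ qcs)).
(* Close up the path from one free cell to the other through [c]. *)
pose W' v := W v (+) on_ray (side c d) v (+) on_ray (side c (lturn d)) v.
have d12 : side c d != side c (lturn d).
  by apply/negP => /eqP/side_inj; case: d {W' pcs qcs c'cs WE} => [[] []].
have W'E g : g \in E -> W' (src g) (+) W' (tgt g) = (g \in pred2 (side c d) (side c (lturn d))).
  move=> gE; have := cross_potential c d g; have := cross_potential c (lturn d) g.
  have := WE g gE; rewrite /W' inE /=.
  have : ~~ ((g == side c d) && (g == side c (lturn d))).
    by apply/negP => /andP[/eqP-> /eqP]; apply/eqP.
  case: (W _) (W _) (on_ray _ _) (on_ray _ _) (on_ray _ _) (on_ray _ _)
    => [] [] [] [] [] [];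
  by case: (strip _ _) (strip _ _) (strip _ _) (_ == _) (_ == _) => [] [] [] [] [].
set g' := side (move (move c d) (lturn d)) (back d).
have star := uniq_star c d.
apply: (cut_vertex (v := corner c d) (g := side c d) (g' := g') conn W'E).
- by move=> e /orP[] /eqP->; rewrite (incident_corner c d) !inE eqxx ?orbT.
- by rewrite Ecs mem_graph_of ccs.
- by rewrite Ecs mem_graph_of c'cs.
- by rewrite (incident_corner c d) !inE eqxx.
- by rewrite (incident_corner c d) !inE eqxx ?orbT.
- by rewrite !inE eqxx.
- move: star; rewrite /= !inE !negb_or /g' => /andP[/and3P[_ h1 _] /andP[/andP[h2 _] _]].
  by rewrite eq_sym h1 eq_sym h2.
Qed.

(** * Vertex degrees along a chain *)

Lemma deg_corner E c d : let c' := move (move c d) (lturn d) in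
  deg E (corner c d) = ((side c d \in E) + (side c (lturn d) \in E)
     + (side c' (back d) \in E) + (side c' (back (lturn d)) \in E))%N.
Proof.
move=> c'; set star := [:: side c d; side c (lturn d); side c' (back d); side c' (back (lturn d))].
rewrite /deg; transitivity (size [seq e <- star | e \in E]).
  apply: perm_size; apply: uniq_perm; rewrite ?fset_uniq ?filter_uniq ?uniq_star // => e.
  by rewrite mem_filter -incident_corner !inE /=.
by rewrite size_filter /= !addnA addn0.
Qed.

Lemma backK : involutive back. Proof. by case=> [[] []]. Qed.
Lemma lturnK : cancel lturn rturn. Proof. by case=> [[] []]. Qed.
Lemma rturnK : cancel rturn lturn. Proof. by case=> [[] []]. Qed.
Lemma rturn_back d : rturn (back d) = lturn d. Proof. by case: d => [[] []]. Qed.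
Lemma lturn_lturn d : lturn (lturn d) = back d. Proof. by case: d => [[] []]. Qed.
Lemma rturn_rturn d : rturn (rturn d) = back d. Proof. by case: d => [[] []]. Qed.

Lemma move_backL c d d' : move (move (move c d) d') (back d) = move c d'.
Proof. by rewrite moveC moveK. Qed.

(** An edge at the corner is present when one of the two cells along it is. *)
Lemma deg_corner_graph_of t c d : let p := move c d in let q := move c (lturn d) in
  let c' := move p (lturn d) in
  deg (graph_of t) (corner c d) =
   (((c \in t) || (p \in t)) + ((c \in t) || (q \in t))
     + ((c' \in t) || (q \in t)) + ((c' \in t) || (p \in t)))%N.
Proof. by move=> p q c'; rewrite deg_corner !mem_graph_of move_backL moveK. Qed.

Definition sq (cs : seq cell) (i : nat) : cell := nth (0, 0) cs i.
Arguments sq : simpl never.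

(** In a chain the default value can be reached only from the last square on. *)
Definition heading (cs : seq cell) (i : nat) : dir :=
  odflt (false, false) [pick d | sq cs i.+1 == move (sq cs i) d].

(** Terminal squares do not turn, so that sums over all positions need no
    boundary conditions. *)
Definition left_turn cs i :=
  [&& (0 < i)%N, (i.+1 < size cs)%N & heading cs i == lturn (heading cs i.-1)].
Definition right_turn cs i :=
  [&& (0 < i)%N, (i.+1 < size cs)%N & heading cs i == rturn (heading cs i.-1)].
Definition turning cs i := left_turn cs i || right_turn cs i.

Lemma left_turn0 cs : left_turn cs 0 = false. Proof. by []. Qed.
Lemma right_turn0 cs : right_turn cs 0 = false. Proof. by []. Qed.
Lemma left_turn_out cs i : (size cs <= i.+1)%N -> left_turn cs i = false.
Proof. by move=> h; rewrite /left_turn [(_ < size cs)%N]ltnNge h andbF. Qed.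
Lemma right_turn_out cs i : (size cs <= i.+1)%N -> right_turn cs i = false.
Proof. by move=> h; rewrite /right_turn [(_ < size cs)%N]ltnNge h andbF. Qed.

Section Chain.
Variables (E : graph) (cs : seq cell).
Hypothesis chainE : polyomino_chain E cs.
Local Notation n := (size cs).
Local Notation C := (sq cs).
Local Notation h := (heading cs).

Lemma chain_graph : E = graph_of cs.
Proof. by case: chainE => sysE _ csE _; apply: system_graph_of. Qed.

Lemma sq_inj i j : (i < n)%N -> (j < n)%N -> C i = C j -> i = j.
Proof.
by case: chainE => _ uniq_cs _ _ iltn jltn /eqP; rewrite nth_uniq // => /eqP.
Qed.

Lemma sq_in i : (i < n)%N -> C i \in cs. Proof. exact: mem_nth. Qed.

Lemma sq_move i : (i.+1 < n)%N -> C i.+1 = move (C i) (h i).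
Proof.
move=> iltn; rewrite /heading; case: pickP => [d /eqP//|no] /=.
have /adjacentP[d eqd] : adjacent (C i) (C i.+1).
  by case: chainE => _ _ _ ->; rewrite ?eqxx // ltnW.
by have := no d; rewrite eqd eqxx.
Qed.

Lemma adjacent_sq i j d : (i < n)%N -> (j < n)%N -> C j = move (C i) d ->
  (j == i.+1) || (i == j.+1).
Proof.
move=> iltn jltn eqC; case: chainE => _ _ _ <- //; apply/adjacentP.
by exists d.
Qed.

Lemma neighbour_in i d : (i < n)%N -> (move (C i) d \in cs) =
  ((i.+1 < n)%N && (d == h i)) || ((0 < i)%N && (d == back (h i.-1))).
Proof.
move=> iltn; apply/idP/orP => [/(nthP (0, 0))[j jltn /= eqj]|[]/andP[]]; first last.
- case: i iltn => // i iltn _ /eqP->.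
  by rewrite sq_move // moveK sq_in // ltnW.
- by move=> i1 /eqP->; rewrite -sq_move // sq_in.
have /orP[/eqP ji|/eqP ij] := adjacent_sq iltn jltn eqj; [left|right].
  by rewrite -ji jltn /= -(inj_eq (@move_inj (C i))) -eqj -sq_move -?ji.
by rewrite ij /= -(inj_eq (@move_inj (C i))) -eqj ij sq_move -?ij // moveK.
Qed.

Lemma heading_back i : (i.+2 < n)%N -> h i.+1 != back (h i).
Proof.
move=> iltn; apply/eqP => eqh.
have : C i.+2 = C i by rewrite !sq_move // ?eqh ?moveK // ltnW.
by move=> /sq_inj H; have := H iltn (ltnW (ltnW iltn)); lia.
Qed.

(** Otherwise the square three steps further would be adjacent to the present one.
    Hence two consecutive kinks turn in opposite directions. *)
Lemma heading_back2 i : (i.+3 < n)%N -> h i.+2 != back (h i).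
Proof.
move=> iltn; apply/eqP => eqh.
have : C i.+3 = move (C i) (h i.+1).
  by rewrite (sq_move iltn) sq_move ?(ltnW iltn) // sq_move ?eqh ?move_backL //; lia.
by move=> /adjacent_sq; rewrite iltn => H; have := H _ isT; lia.
Qed.

Lemma headingP i : (i.+2 < n)%N ->
  [|| h i.+1 == h i, h i.+1 == lturn (h i) | h i.+1 == rturn (h i)].
Proof.
by move=> /heading_back; case: (h i) (h i.+1) => [[] []] [[] []].
Qed.

Lemma turningE i : (0 < i)%N -> (i.+1 < n)%N -> turning cs i = (h i != h i.-1).
Proof.
case: i => // i _ iltn; rewrite /turning /left_turn /right_turn iltn /=.
by have := headingP iltn; case: (h i) (h i.+1) => [[] []] [[] []].
Qed.

Lemma turns_exclusive i : left_turn cs i && right_turn cs i = false.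
Proof.
rewrite /left_turn /right_turn; case: (h i) (h i.-1) => [[] []] [[] []];
  by rewrite ?andbF.
Qed.

Lemma left_alternate i : left_turn cs i && left_turn cs i.+1 = false.
Proof.
apply/negP => /andP[/and3P[]]; case: i => // i _ _ /eqP eq1 /and3P[_ iltn /eqP eq2].
by have := heading_back2 iltn; rewrite eq2 eq1 lturn_lturn eqxx.
Qed.

Lemma right_alternate i : right_turn cs i && right_turn cs i.+1 = false.
Proof.
apply/negP => /andP[/and3P[]]; case: i => // i _ _ /eqP eq1 /and3P[_ iltn /eqP eq2].
by have := heading_back2 iltn; rewrite eq2 eq1 rturn_rturn eqxx.
Qed.

(** Three of the four edges at a corner of two adjacent squares belong to these
    squares; the fourth is an edge if one more square is present there. *)
Lemma deg_shared c d : c \in cs -> move c d \in cs -> deg E (corner c d) =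
  (3 + ((move c (lturn d) \in cs) || (move (move c d) (lturn d) \in cs)))%N.
Proof. by move=> c0 c1; rewrite chain_graph deg_corner_graph_of c0 c1 /= orbT orbC; lia. Qed.

(** The diagonally opposite cell is absent because squares of the chain do not meet
    in a corner only. *)
Lemma deg_outer c d : c \in cs -> move c d \notin cs -> move c (lturn d) \notin cs ->
  deg E (corner c d) = 2%N.
Proof.
move=> c0 c1 c2; have [sysE _ csE _] := chainE.
have c3 := no_corner_contact sysE csE c0 c1 c2.
by rewrite chain_graph deg_corner_graph_of c0 (negPf c1) (negPf c2) (negPf c3).
Qed.

Lemma deg_left i : (i.+1 < n)%N ->
  deg E (corner (C i) (h i)) = (3 + (left_turn cs i || left_turn cs i.+1))%N.
Proof.
move=> iltn; have i0 : (i < n)%N by apply: ltnW.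
rewrite deg_shared -?sq_move ?sq_in // !neighbour_in // iltn /=.
congr (3 + nat_of_bool (_ || _))%N; rewrite /left_turn ?iltn /=.
  case: i {i0} iltn => [|i] iltn /=; first by case: (h 0) => [[] []].
  by case: (h i) (h i.+1) => [[] []] [[] []].
by case: (h i) (h i.+1) => [[] []] [[] []]; rewrite ?orbF.
Qed.

Lemma deg_right i : (i.+1 < n)%N ->
  deg E (corner (C i) (rturn (h i))) = (3 + (right_turn cs i || right_turn cs i.+1))%N.
Proof.
move=> iltn; have i0 : (i < n)%N by apply: ltnW.
rewrite corner_rturn -sq_move //.
have eqC : move (C i.+1) (back (h i)) = C i by rewrite sq_move // moveK.
rewrite deg_shared ?eqC ?sq_in // !neighbour_in // iltn /= orbC.
congr (3 + nat_of_bool (_ || _))%N; rewrite /right_turn ?iltn /=.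
  case: i {i0 eqC} iltn => [|i] iltn /=; first by case: (h 0) => [[] []].
  by case: (h i) (h i.+1) => [[] []] [[] []].
by case: (h i) (h i.+1) => [[] []] [[] []]; rewrite ?orbF.
Qed.

Lemma deg_outer_left i : left_turn cs i -> deg E (corner (C i) (rturn (h i.-1))) = 2%N.
Proof.
case: i => // i /and3P[_ iltn /= /eqP eqh]; have i0 := ltnW iltn.
by apply: deg_outer; rewrite ?sq_in // neighbour_in // iltn eqh /=; case: (h i) => [[] []].
Qed.

Lemma deg_outer_right i : right_turn cs i -> deg E (corner (C i) (h i.-1)) = 2%N.
Proof.
case: i => // i /and3P[_ iltn /= /eqP eqh]; have i0 := ltnW iltn.
by apply: deg_outer; rewrite ?sq_in // neighbour_in // iltn eqh /=; case: (h i) => [[] []].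
Qed.

Lemma deg_first_left : (1 < n)%N -> deg E (corner (C 0) (lturn (h 0))) = 2%N.
Proof.
move=> n1; have n0 := ltnW n1.
by apply: deg_outer; rewrite ?sq_in // neighbour_in // n1 orbF; case: (h 0) => [[] []].
Qed.

Lemma deg_first_right : (1 < n)%N -> deg E (corner (C 0) (back (h 0))) = 2%N.
Proof.
move=> n1; have n0 := ltnW n1.
by apply: deg_outer; rewrite ?sq_in // neighbour_in // n1 orbF; case: (h 0) => [[] []].
Qed.

Lemma deg_last_left i : n = i.+2 -> deg E (corner (C i.+1) (h i)) = 2%N.
Proof.
move=> ni; have i1 : (i.+1 < n)%N by rewrite ni.
by apply: deg_outer; rewrite ?sq_in // neighbour_in // ni ltnn /=; case: (h i) => [[] []].
Qed.

Lemma deg_last_right i : n = i.+2 -> deg E (corner (C i.+1) (rturn (h i))) = 2%N.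
Proof.
move=> ni; have i1 : (i.+1 < n)%N by rewrite ni.
by apply: deg_outer; rewrite ?sq_in // neighbour_in // ni ltnn /=; case: (h i) => [[] []].
Qed.

End Chain.

(** * The index as a sum over turns *)

Lemma sum_dirs (V : comNzRingType) (F : dir -> V) d :
  \sum_x F x = F d + F (lturn d) + F (back d) + F (rturn d).
Proof.
rewrite (eq_bigr (fun x => F (x.1, x.2))) => [|[] //].
rewrite -(pair_bigA _ (fun x y => F (x, y))) /= !big_bool /=.
by case: d => [[] []]; rewrite /lturn /rturn /back /lturn /=; ring.
Qed.

Section EdgeSum.
Variables (R : realType) (theta : nat -> nat -> R).
Hypothesis theta_sym : forall a b : nat, theta a b = theta b a.
Variables (E : graph) (cs : seq cell).
Hypothesis chainE : polyomino_chain E cs.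
Local Notation n := (size cs).
Local Notation C := (sq cs).
Local Notation h := (heading cs).

(** Marks the side through which the chain leaves the square; that side is charged
    to the next square. *)
Definition exits i d := (i.+1 < n)%N && (d == h i).

Definition edge_weight (e : gedge) : R := theta (deg E (src e)) (deg E (tgt e)).

Lemma edge_weight_side c d : edge_weight (side c d) =
  theta (deg E (corner c d)) (deg E (corner c (rturn d))).
Proof.
rewrite /edge_weight; case: c d => x y [[] []]; [rewrite theta_sym| | |rewrite theta_sym];
  by congr (theta (deg E _) (deg E _)); coords; congr pair; lia.
Qed.

Lemma mem_later_sides i d : (i < n)%N ->
  (side (C i) d \in all_sides (drop i.+1 cs)) = exits i d.
Proof.
move=> iltn; apply/flatten_mapP/andP => [[c cdrop]|[i1 /eqP->]]; last first.
  exists (C i.+1); last by rewrite mem_side (sq_move chainE) // eqxx orbT.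
  by rewrite /sq -[X in nth _ _ X]addn0 -nth_drop mem_nth // size_drop subn_gt0.
have [j jlt eqc] := nthP (0, 0) cdrop; rewrite size_drop in jlt.
have jn : (i.+1 + j < n)%N by rewrite -ltn_subRL.
have {}eqc : c = C (i.+1 + j) by rewrite -eqc nth_drop.
rewrite mem_side eqc => /orP[/eqP/(sq_inj chainE jn iltn)|/eqP eqm]; first lia.
have := adjacent_sq chainE iltn jn eqm; rewrite (_ : (i == _) = false); last lia.
rewrite orbF => /eqP j0; rewrite j0 in jn eqm; split=> //.
by rewrite -(inj_eq (@move_inj (C i))) -eqm (sq_move chainE).
Qed.

(** Each edge is charged to the last square of which it is a side. *)
Lemma TI_by_squares : TI theta E =
  \sum_(0 <= i < n) \sum_(d | ~~ exits i d) edge_weight (side (C i) d).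
Proof.
have -> : TI theta E = \sum_(e <- undup (all_sides cs)) edge_weight e.
  rewrite /TI; apply: perm_big; apply: uniq_perm; rewrite ?fset_uniq ?undup_uniq //.
  by move=> e; rewrite mem_undup (chain_graph chainE) in_fset.
(* Induction on the number of squares left, from the end of the chain. *)
rewrite -{1}[cs]drop0; move: (leq0n n); move: 0%N => k.
move: {-2}(n - k)%N (erefl (n - k)%N) => m; elim: m k => [|m IH] k nk kn.
  have -> : k = n by lia.
  by rewrite drop_size big_geq // big_nil.
have k1 : (k < n)%N by lia.
rewrite (drop_nth (0, 0)) // big_ltn // -IH; [|lia|lia].
have -> c t : all_sides (c :: t) = sides c ++ all_sides t by [].
rewrite undup_cat big_cat; congr (_ + _).
have P : perm_eq (undup (sides (C k))) [seq side (C k) d | d : dir].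
  rewrite undup_id ?perm_sides // (perm_uniq (perm_sides _)).
  by rewrite map_inj_uniq ?enum_uniq //; apply: side_inj.
rewrite big_filter (perm_big _ P).
rewrite big_map big_enum_cond /=; apply: eq_bigl => d.
by rewrite mem_later_sides.
Qed.

Lemma sum_not_exit i (F : dir -> R) : (i.+1 < n)%N ->
  \sum_(d | ~~ exits i d) F d = F (lturn (h i)) + F (back (h i)) + F (rturn (h i)).
Proof.
move=> iltn; apply: (addrI (F (h i))); rewrite !addrA -sum_dirs [RHS](bigD1 (h i)) //=.
by congr (_ + _); apply: eq_bigl => d; rewrite /exits iltn.
Qed.

(** Two kinks at distance two around a straight square, turning the same way: the
    straight square then has one side joining vertices of degree 4 and the opposite
    one joining vertices of degree 3. *)
Definition same_side i := ~~ turning cs i.+1 &&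
  (left_turn cs i && left_turn cs i.+2 || right_turn cs i && right_turn cs i.+2).

Local Notation "'k_ i" := ((turning cs i)%:R : R) (at level 8, i at level 2).

Lemma owned_first : (2 < n)%N -> \sum_(d | ~~ exits 0 d) edge_weight (side (C 0) d) =
  theta 2 2 + 2 * theta 2 3 + (theta 2 4 - theta 2 3) * 'k_1.
Proof.
move=> n2; have n1 := ltnW n2; rewrite sum_not_exit // !edge_weight_side.
rewrite lturnK rturn_back rturn_rturn (deg_left chainE) // (deg_right chainE) //.
rewrite (deg_first_left chainE) // (deg_first_right chainE) // left_turn0 right_turn0 /turning /=.
have := turns_exclusive cs 1.
by case: (left_turn _ _) (right_turn _ _) => [] [] //= _; rewrite ?(theta_sym 3) ?(theta_sym 4); ring.
Qed.

Lemma owned_last i : n = i.+3 ->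
  \sum_(d | ~~ exits i.+2 d) edge_weight (side (C i.+2) d) =
  edge_weight (side (C i.+1) (h i.+1)) + theta 2 2 + 2 * theta 2 3 + (theta 2 4 - theta 2 3) * 'k_i.+1.
Proof.
move=> ni; have i1 : (i.+2 < n)%N by rewrite ni.
rewrite (eq_bigl xpredT) => [|d]; last by rewrite /exits ni ltnn.
rewrite (sum_dirs _ (h i.+1)) !edge_weight_side.
rewrite lturnK rturn_back rturn_rturn.
rewrite (deg_last_left chainE) // (deg_last_right chainE) //.
have -> : corner (C i.+2) (back (h i.+1)) = corner (C i.+1) (rturn (h i.+1)).
  by rewrite corner_rturn (sq_move chainE).
have -> : corner (C i.+2) (lturn (h i.+1)) = corner (C i.+1) (h i.+1).
  by rewrite -rturn_back corner_rturn (sq_move chainE) // moveK backK.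
rewrite (deg_left chainE) // (deg_right chainE) //.
rewrite (@left_turn_out _ i.+2) ?ni // (@right_turn_out _ i.+2) ?ni // !orbF /turning.
have := turns_exclusive cs i.+1.
by case: (left_turn _ _) (right_turn _ _) => [] [] //= _; rewrite ?(theta_sym 3) ?(theta_sym 4); ring.
Qed.

(** The entry side contributes as any shared side.  If the square is straight, the
    other two sides join left ends to left ends and right ends to right ends; if it
    is a kink, they join its outer corner to two ends of shared sides. *)
Lemma owned_middle i : (i.+2 < n)%N ->
  \sum_(d | ~~ exits i.+1 d) edge_weight (side (C i.+1) d) =
  3 * theta 3 3 + (theta 3 4 - theta 3 3) * ('k_i + 'k_i.+1)
  + (theta 3 3 - 2 * theta 3 4 + theta 4 4) * ('k_i * 'k_i.+1)
  + 2 * (theta 2 3 - theta 3 3) * 'k_i.+1 + (theta 3 4 - theta 3 3) * ('k_i + 'k_i.+2)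
  + (theta 2 4 - theta 2 3 - theta 3 4 + theta 3 3) * ('k_i * 'k_i.+1 + 'k_i.+1 * 'k_i.+2)
  + (theta 3 3 - 2 * theta 3 4 + theta 4 4) * (same_side i)%:R.
Proof.
move=> i2; have i1 := ltnW i2; rewrite sum_not_exit // !edge_weight_side.
rewrite lturnK rturn_back rturn_rturn.
have dL := deg_left chainE i1; have dR := deg_right chainE i1.
have dL' := deg_left chainE i2; have dR' := deg_right chainE i2.
have eqR : corner (C i.+1) (back (h i)) = corner (C i) (rturn (h i)).
  by rewrite corner_rturn (sq_move chainE).
have eqL : corner (C i.+1) (lturn (h i)) = corner (C i) (h i).
  by rewrite -rturn_back corner_rturn (sq_move chainE) // moveK backK.
rewrite -eqR in dR; rewrite -eqL in dL.
have e0 := turns_exclusive cs i; have e1 := turns_exclusive cs i.+1.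
have e2 := turns_exclusive cs i.+2.
have a0 := left_alternate chainE i; have a1 := left_alternate chainE i.+1.
have b0 := right_alternate chainE i; have b1 := right_alternate chainE i.+1.
have /or3P[] := headingP chainE i2 => /eqP eqh.
- have L0 : left_turn cs i.+1 = false.
    by rewrite /left_turn i2 eqh; case: (h i) => [[] []].
  have R0 : right_turn cs i.+1 = false.
    by rewrite /right_turn i2 eqh; case: (h i) => [[] []].
  rewrite eqh in dL' dR' *; rewrite dL dR dL' dR' /same_side /turning L0 R0 !orbF.
  move: e0 e2; case: (left_turn _ i) (right_turn _ i) (left_turn _ i.+2) (right_turn _ i.+2)
    => [] [] [] [] //= _ _; rewrite ?(theta_sym 3) ?(theta_sym 4); ring.
- have L1 : left_turn cs i.+1 by rewrite /left_turn i2 eqh eqxx.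
  have dO := deg_outer_left chainE L1.
  rewrite eqh lturnK in dL' dR'; rewrite eqh lturn_lturn lturnK -/(rturn _) dO dR dL' dR'.
  move: e0 e1 e2 a0 a1; rewrite /same_side /turning L1.
  case: (right_turn _ i.+1) => //=; rewrite !andbT !orbF => _ _ _ -> ->.
  case: (right_turn _ i) (right_turn _ i.+2) => [] [] /=;
    rewrite ?(theta_sym 3) ?(theta_sym 4); ring.
- have R1 : right_turn cs i.+1 by rewrite /right_turn i2 eqh eqxx.
  have dO := deg_outer_right chainE R1.
  rewrite eqh rturn_rturn in dL' dR'; rewrite eqh rturnK rturn_rturn [back (rturn _)]backK.
  rewrite dO dL dL' dR'.
  move: e0 e1 e2 b0 b1; rewrite /same_side /turning R1.
  case: (left_turn _ i.+1) => //=; rewrite !andbT !orbF ?orbT => _ _ _ -> ->.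
  case: (left_turn _ i) (left_turn _ i.+2) => [] [] /=;
    rewrite ?(theta_sym 3) ?(theta_sym 4); ring.
Qed.

(** The left end has degree 4 if one of the two squares turns left, the right end if
    one of them turns right.  Consecutive turns being opposite, the kinks among the
    two squares contribute to different ends. *)
Lemma edge_weight_shared i : (i.+1 < n)%N -> edge_weight (side (C i) (h i)) =
  theta 3 3 + (theta 3 4 - theta 3 3) * ('k_i + 'k_i.+1)
  + (theta 3 3 - 2 * theta 3 4 + theta 4 4) * ('k_i * 'k_i.+1).
Proof.
move=> i1; rewrite edge_weight_side (deg_left chainE) // (deg_right chainE) // /turning.
have := turns_exclusive cs i; have := turns_exclusive cs i.+1.
have := left_alternate chainE i; have := right_alternate chainE i.
case: (left_turn _ i) (left_turn _ i.+1) (right_turn _ i) (right_turn _ i.+1)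
  => [] [] [] [] //= _ _ _ _; rewrite ?(theta_sym 3) ?(theta_sym 4); ring.
Qed.

(** The sum of the local contributions: every shift of the sum of the kink
    indicators differs from that sum by a boundary term only. *)
Lemma TI_by_turns : (2 < n)%N -> TI theta E =
  3 * n%:R * theta 3 3 - 5 * theta 3 3 + 2 * theta 2 2 + 4 * theta 2 3
  + (2 * theta 2 3 - 6 * theta 3 3 + 4 * theta 3 4) * (\sum_(0 <= i < n) 'k_i)
  + (theta 2 4 - theta 2 3 + theta 3 3 - theta 3 4) * ('k_1 + 'k_n.-2)
  + (theta 3 3 - 2 * theta 3 4 + theta 4 4) * (\sum_(0 <= i < n) (same_side i)%:R)
  + (2 * theta 2 4 - 2 * theta 2 3 + 3 * theta 3 3 - 4 * theta 3 4 + theta 4 4)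
     * (\sum_(0 <= i < n) 'k_i * 'k_i.+1).
Proof.
move=> n2; rewrite TI_by_squares; have [m nm] : exists m, n = m.+3 by exists (n - 3)%N; lia.
have k0 : 'k_0 = 0 by [].
have kend i : (m.+2 <= i)%N -> 'k_i = 0.
  by move=> mi; rewrite /turning left_turn_out ?right_turn_out // nm.
have ssend i : (m.+1 <= i)%N -> (same_side i)%:R = 0 :> R.
  move=> mi; have h2 : (n <= i.+3)%N by lia.
  by rewrite /same_side (left_turn_out h2) (right_turn_out h2) !andbF.
rewrite nm; rewrite [LHS]big_nat_recr // big_nat_recl //= -nm owned_first // (owned_last nm).
rewrite edge_weight_shared; last lia.
rewrite (eq_big_nat _ _ (F2 := fun i => 3 * theta 3 3 + (theta 3 4 - theta 3 3) * ('k_i + 'k_i.+1)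
  + (theta 3 3 - 2 * theta 3 4 + theta 4 4) * ('k_i * 'k_i.+1)
  + 2 * (theta 2 3 - theta 3 3) * 'k_i.+1 + (theta 3 4 - theta 3 3) * ('k_i + 'k_i.+2)
  + (theta 2 4 - theta 2 3 - theta 3 4 + theta 3 3) * ('k_i * 'k_i.+1 + 'k_i.+1 * 'k_i.+2)
  + (theta 3 3 - 2 * theta 3 4 + theta 4 4) * (same_side i)%:R)); last first.
  by move=> i /andP[_ im]; apply: owned_middle; lia.
rewrite !big_split /= -!mulr_sumr !big_split /= sumr_const_nat subn0.
(* The indicators vanish at the position 0 and from n - 1 on, so these truncated
   sums equal the full ones. *)
set K := \sum_(0 <= i < m.+1) 'k_i.+1.
set A := \sum_(0 <= i < m.+1) 'k_i * 'k_i.+1.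
have -> : \sum_(0 <= i < m.+1) 'k_i = K - 'k_m.+1.
  by rewrite /K big_nat_recl // k0 add0r [in RHS]big_nat_recr //= addrK.
have -> : \sum_(0 <= i < m.+1) 'k_i.+2 = K - 'k_1.
  by rewrite /K [in RHS]big_nat_recl // big_nat_recr //= (kend m.+2) // addr0 addrC addKr.
have -> : \sum_(0 <= i < m.+1) 'k_i.+1 * 'k_i.+2 = A.
  by rewrite /A big_nat_recr // [in RHS]big_nat_recl //= k0 mul0r add0r (kend m.+2) // mulr0 addr0.
rewrite nm.
have -> : \sum_(0 <= i < m.+3) 'k_i = K.
  by rewrite big_nat_recl // big_nat_recr //= k0 add0r (kend m.+2) // addr0.
have -> : \sum_(0 <= i < m.+3) 'k_i * 'k_i.+1 = A.
  by rewrite big_nat_recr // big_nat_recr //= (kend m.+2) // mulr0 mul0r !addr0.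
have -> : \sum_(0 <= i < m.+3) (same_side i)%:R = \sum_(0 <= i < m.+1) (same_side i)%:R :> R.
  by rewrite big_nat_recr // big_nat_recr //= !ssend // !addr0.
by rewrite /= (kend m.+2) // -[_ *+ m.+1]mulr_natr; ring.
Qed.

End EdgeSum.

(** * Subchains of a chain *)

Definition avoiding (E : graph) (w : point) : rel point :=
  fun a b => [&& neighbours E a b, a != w & b != w].

(** Unlike in the definition of 2-connected graphs, [w] need not be a vertex; this
    makes the property pass to unions. *)
Definition biconnected (E : graph) : Prop := forall w u v,
  u \in vertices E -> v \in vertices E -> u != w -> v != w -> linked (avoiding E w) u v.

Lemma avoiding_sym E w : symmetric (avoiding E w).
Proof. by move=> a b; rewrite /avoiding neighbours_sym [(a != w) && _]andbC. Qed.

Lemma avoiding_mono (E E' : graph) w : {subset E <= E'} -> subrel (avoiding E w) (avoiding E' w).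
Proof.
move=> EE' a b /and3P[/neighboursP[e [eE ae be ab]] aw bw]; apply/and3P; split=> //.
by apply/neighboursP; exists e; split=> //; apply: EE'.
Qed.

(** Paths avoiding a point [w] far from both ends are ordinary paths. *)
Lemma two_connected_intro E : (2 < #|` vertices E |)%N -> biconnected E -> two_connected E.
Proof.
move=> cardV conn; split=> // [u v uV vV|w u v _]; last exact: conn.
(* The first coordinate exceeds those of [u] and [v]. *)
pose w : point := (`|u.1| + `|v.1| + 1, 0).
have uw : u != w by case: u {uV} @w => x y /=; rewrite xpair_eqE; lia.
have vw : v != w by case: v {vV uw} @w => x y /=; rewrite xpair_eqE; lia.
by apply: linked_mono (conn w u v uV vV uw vw) => a b /andP[].
Qed.

(** Of the two common vertices at least one survives the removal of [w]. *)
Lemma biconnected_glue (E E1 E2 : graph) a b : {subset E1 <= E} -> {subset E2 <= E} ->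
  (forall e, e \in E -> (e \in E1) || (e \in E2)) -> a != b ->
  a \in vertices E1 -> b \in vertices E1 -> a \in vertices E2 -> b \in vertices E2 ->
  biconnected E1 -> biconnected E2 -> biconnected E.
Proof.
move=> s1 s2 s12 ab a1 b1 a2 b2 conn1 conn2 w u v uV vV uw vw.
have [x [xw x1 x2]] : exists x, [/\ x != w, x \in vertices E1 & x \in vertices E2].
  have [eaw|naw] := eqVneq a w; last by exists a.
  by exists b; rewrite -eaw eq_sym.
have to_x y : y \in vertices E -> y != w -> linked (avoiding E w) y x.
  move=> /in_vertices[e /s12/orP[] eE ye] yw.
    apply: linked_mono (conn1 w y x _ x1 yw xw); first exact: avoiding_mono.
    by apply/in_vertices; exists e.
  apply: linked_mono (conn2 w y x _ x2 yw xw); first exact: avoiding_mono.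
  by apply/in_vertices; exists e.
apply: linked_trans (to_x u uV uw) _.
by apply: linked_sym (to_x v vV vw); apply: avoiding_sym.
Qed.

Lemma graph_of_cons c t e : (e \in graph_of (c :: t)) = (e \in sides c) || (e \in graph_of t).
Proof. by rewrite !in_fset -mem_cat. Qed.

Lemma graph_of1 c e : (e \in graph_of [:: c]) = (e \in sides c).
Proof. by rewrite graph_of_cons [X in _ || X]in_fset in_nil orbF. Qed.

Lemma corner_inj c : injective (corner c).
Proof. by case: c => x y [[] []] [[] []] //; coords => -[]; lia. Qed.

Lemma corner_vertex t c d : c \in t -> corner c d \in vertices (graph_of t).
Proof.
move=> ct; apply/in_vertices; exists (side c d); first by rewrite mem_graph_of ct.
by rewrite corner_side eqxx.
Qed.

(** Two opposite corners are joined by two disjoint paths around the square. *)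
Lemma square_biconnected c : biconnected (graph_of [:: c]).
Proof.
have corners_only u : u \in vertices (graph_of [:: c]) -> exists d, u = corner c d.
  move=> /in_vertices[e]; rewrite graph_of1 => /sidesP[d ->].
  by rewrite corner_side => /orP[]/eqP->; [exists d|exists (rturn d)].
have step w d : corner c d != w -> corner c (rturn d) != w ->
    avoiding (graph_of [:: c]) w (corner c d) (corner c (rturn d)).
  move=> dw d'w; rewrite /avoiding dw d'w !andbT; apply/neighboursP; exists (side c d).
  rewrite mem_graph_of mem_seq1 eqxx !corner_side !eqxx orbT (inj_eq (@corner_inj c)).
  by split=> //; case: d {dw d'w} => [[] []].
have step' w d : corner c d != w -> corner c (lturn d) != w ->
    avoiding (graph_of [:: c]) w (corner c d) (corner c (lturn d)).
  by move=> dw d'w; rewrite avoiding_sym -{2}[d]lturnK step // lturnK.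
move=> w _ _ /corners_only[d ->] /corners_only[d' ->] dw d'w.
have : [|| d' == d, d' == rturn d, d' == lturn d | d' == back d] by case: d d' {dw d'w} => [[] []] [[] []].
case/or4P => /eqP eqd; rewrite eqd in d'w *; first exact: linked_refl.
- exact: linked1 (step _ _ _ _).
- exact: linked1 (step' _ _ _ _).
- have [eqw|neqw] := eqVneq (corner c (lturn d)) w.
    have rw : corner c (rturn d) != w.
      by rewrite -eqw (inj_eq (@corner_inj c)); case: d {dw d'w eqd eqw} => [[] []].
    rewrite -rturn_rturn in d'w *.
    exact: linked_step (step _ _ dw rw) (linked1 (step _ _ rw d'w)).
  rewrite -lturn_lturn in d'w *.
  exact: linked_step (step' _ _ dw neqw) (linked1 (step' _ _ neqw d'w)).
Qed.

Lemma path_biconnected c t : path adjacent c t -> biconnected (graph_of (c :: t)).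
Proof.
elim: t c => [|c' t IH] c /=; first by move=> _; apply: square_biconnected.
case/andP => /adjacentP[d eqc'] /IH conn.
have c't : c' \in c' :: t by rewrite inE eqxx.
refine (@biconnected_glue _ _ _ (corner c d) (corner c (rturn d)) _ _ _ _ _ _ _ _
  (@square_biconnected c) conn).
- by move=> e; rewrite graph_of1 graph_of_cons => ->.
- by move=> e et; rewrite graph_of_cons et orbT.
- by move=> e; rewrite graph_of1 -graph_of_cons.
- by rewrite (inj_eq (@corner_inj c)); case: d {eqc'} => [[] []].
- by apply: corner_vertex; rewrite inE.
- by apply: corner_vertex; rewrite inE.
- have -> : corner c d = corner c' (rturn (back d)).
    by rewrite corner_rturn eqc' moveK backK.
  exact: corner_vertex.
- by rewrite corner_rturn -eqc'; apply: corner_vertex.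
Qed.

Lemma path_two_connected c t : path adjacent c t -> two_connected (graph_of (c :: t)).
Proof.
move=> /path_biconnected conn; apply: two_connected_intro => //.
have ct : c \in c :: t by rewrite inE eqxx.
pose V := [fset corner c (false, false); corner c (true, false); corner c (false, true)]%fset.
have cardV : #|` V| = 3%N.
  by rewrite /V fsetUC cardfsU1 cardfs2 !inE !(inj_eq (@corner_inj c)).
rewrite -cardV; apply: fsubset_leq_card; apply/fsubsetP => v.
rewrite [X in is_true X -> _]in_fsetU [X in is_true (X || _) -> _]in_fset2 in_fset1.
by move=> /orP[/orP[]|] /eqP->; apply: corner_vertex.
Qed.

Lemma infix_sq (t cs : seq cell) : infix t cs -> exists2 a, (a + size t <= size cs)%N &
  forall i, (i < size t)%N -> sq t i = sq cs (a + i).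
Proof.
move=> /infixP[p [s ->]]; exists (size p); first by rewrite !size_cat addnA leq_addr.
move=> i it; rewrite /sq nth_cat ltnNge leq_addr /= addKn nth_cat.
by rewrite it.
Qed.

Section Subchain.
Variables (E : graph) (cs : seq cell).
Hypothesis chainE : polyomino_chain E cs.
Local Notation n := (size cs).
Local Notation C := (sq cs).
Local Notation h := (heading cs).
Variables (t : seq cell) (a : nat).
Hypothesis t_fits : (a + size t <= n)%N.
Hypothesis t_sq : forall i, (i < size t)%N -> sq t i = C (a + i).

Lemma sq_in_block j : (j < n)%N -> (C j \in t) = (a <= j < a + size t)%N.
Proof.
move=> jn; apply/idP/idP => [/(nthP (0, 0))[i it eqi]|/andP[aj jt]].
  have {}it : (i < size t)%N := it.
  have ai : (a + i < n)%N by lia.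
  have := sq_inj chainE jn ai; rewrite -t_sq // => -> //; lia.
have it : (j - a < size t)%N by lia.
by have := t_sq it; rewrite subnKC // => <-; apply: mem_nth.
Qed.

Lemma block_sub c : c \in t -> c \in cs.
Proof.
move=> /(nthP (0, 0))[i it <-]; have {}it : (i < size t)%N := it.
have := t_sq it; rewrite /sq => ->.
by apply: mem_nth; apply: leq_trans t_fits; rewrite ltn_add2l.
Qed.

Lemma block_graph_sub : {subset graph_of t <= E}.
Proof.
move=> e; have [c [d ->]] := side_edge_ex e; rewrite (chain_graph chainE) !mem_graph_of.
by move=> /orP[] /block_sub->; rewrite ?orbT.
Qed.

Lemma crossable_outside c d : c \notin t -> move c d \notin t ->
  crossable (graph_of t) c (move c d).
Proof.
by move=> ct mt; apply/crossableP; exists d; rewrite // mem_graph_of negb_or ct.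
Qed.

(** Squares of the chain before the block are joined to one another, back to the
    first one, by crossing sides which no longer belong to the graph; the first
    square has a neighbour outside the chain. *)
Lemma escape_down j : (j < n)%N -> (j < a)%N -> exists2 p, p \notin cs & same_face (graph_of t) (C j) p.
Proof.
elim: j => [|j IH] jn ja.
  have pn : move (C 0) (lturn (h 0)) \notin cs.
    by rewrite (neighbour_in chainE) //; case: (h 0) => [[] []]; rewrite andbF.
  exists (move (C 0) (lturn (h 0))) => //; apply: linked1; apply: crossable_outside.
    by rewrite sq_in_block // leqNgt ja.
  by apply: contra pn; apply: block_sub.
have [||p pn jp] := IH _ _; [exact: ltnW|exact: ltnW|].
exists p => //; apply: linked_step jp; rewrite crossable_sym (sq_move chainE) //.
apply: crossable_outside; first by rewrite sq_in_block ?(ltnW jn) // leqNgt (ltnW ja).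
by rewrite -(sq_move chainE) // sq_in_block // leqNgt ja.
Qed.

(** The same towards the last square of the chain. *)
Lemma escape_up j : (j < n)%N -> (a + size t <= j)%N ->
  exists2 p, p \notin cs & same_face (graph_of t) (C j) p.
Proof.
move: {-2}(n - j.+1)%N (erefl (n - j.+1)%N) => m; elim: m j => [|m IH] j nj jn ja.
  have pn : move (C j) (lturn (h j.-1)) \notin cs.
    rewrite (neighbour_in chainE) // (_ : (j.+1 < n)%N = false) ?orFb; last lia.
    by case: (h _) => [[] []]; rewrite andbF.
  exists (move (C j) (lturn (h j.-1))) => //; apply: linked1; apply: crossable_outside.
    by rewrite sq_in_block //; lia.
  by apply: contra pn; apply: block_sub.
have j1 : (j.+1 < n)%N by lia.
have [|||p pn jp] := IH j.+1; [lia|lia|lia|].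
exists p => //; apply: linked_step jp; rewrite (sq_move chainE) //.
apply: crossable_outside; first by rewrite sq_in_block //; lia.
by rewrite -(sq_move chainE) // sq_in_block //; lia.
Qed.

Lemma same_face_sub (E1 E2 : graph) c c' : {subset E1 <= E2} ->
  same_face E2 c c' -> same_face E1 c c'.
Proof.
move=> s12; apply: linked_mono => x y /crossableP[d -> dE]; apply/crossableP; exists d => //.
by apply: contra dE; apply: s12.
Qed.

Lemma square_face c c' : c \in t -> same_face (graph_of t) c c' -> c' = c.
Proof.
move=> ct [[|b p] /=]; first by [].
by case/andP => /crossableP[d _]; rewrite mem_graph_of ct.
Qed.

Lemma outside_exterior c : c \notin t -> ~ in_interior_face (graph_of t) c.
Proof.
move=> ct; have [p pn cp] : exists2 p, p \notin cs & same_face (graph_of t) c p.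
  have [/(nthP (0, 0))[j jn eqc]|cn] := boolP (c \in cs); last first.
    by exists c => //; apply: linked_refl.
  have eqcC : c = C j by []. 
  rewrite eqcC sq_in_block // negb_and -ltnNge -leqNgt in ct; rewrite eqcC.
  by case/orP: ct => [/(escape_down jn)|/(escape_up jn)].
apply/exteriorP => m; have pext : ~ in_interior_face E p.
  by case: chainE => _ _ csE _ /csE; apply/negP.
have [c' pc' fc'] := (exteriorP E p).1 pext m; exists c' => //.
by apply: linked_trans cp (same_face_sub block_graph_sub pc').
Qed.

(** A cell outside the block lies in the exterior face of the graph of the block:
    if it belongs to the chain, walk along the chain away from the block, step out
    at its end, and then escape as in the graph of the whole chain. *)
Lemma block_chain : t != [::] -> polyomino_chain (graph_of t) t.
Proof.
move=> tn0; case: (chainE) => _ uniq_cs _ adj.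
have intP c : c \in t <-> in_interior_face (graph_of t) c.
  split=> [ct|cint]; last by apply/negPn/negP => /outside_exterior.
  by exists (Num.max `|c.1| `|c.2|) => c' /(square_face ct)->; rewrite !le_max !lexx orbT.
have adj_t i j : (i < size t)%N -> (j < size t)%N ->
    adjacent (sq t i) (sq t j) = (j == i.+1) || (i == j.+1).
  move=> it jt; rewrite !t_sq // adj; [|lia|lia].
  by rewrite -!addnS !eqn_add2l.
split=> //.
- split=> [|c /intP ct c']; last exact: square_face.
  case: t tn0 adj_t => // c s _ adj_t; apply: path_two_connected.
  apply/(pathP (0, 0)) => i is_; have := adj_t i i.+1.
  by rewrite /sq /= !ltnS => -> //; rewrite ?eqxx // ltnW.
- have -> : t = take (size t) (drop a cs).
    apply: (@eq_from_nth _ (0, 0)) => [|i it].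
      by rewrite size_takel // size_drop leq_subRL ?(leq_trans _ t_fits) ?leq_addr.
    by rewrite nth_take // nth_drop; apply: t_sq.
  by rewrite take_uniq // drop_uniq.
Qed.

End Subchain.

(** * Kinks *)

Lemma has_sides (p : pred gedge) c d : has p (sides c) =
  [|| p (side c d), p (side c (lturn d)), p (side c (back d)) | p (side c (rturn d))].
Proof.
apply/hasP/or4P => [[e /sidesP[d' ->]] pd'|].
  have : [|| d' == d, d' == lturn d, d' == back d | d' == rturn d].
    by case: d d' {pd'} => [[] []] [[] []].
  by case/or4P => /eqP eqd; rewrite eqd in pd'; constructor.
by case=> pd; [exists (side c d)|exists (side c (lturn d))|exists (side c (back d))
  |exists (side c (rturn d))]; rewrite ?mem_side ?eqxx.
Qed.

(** The edges which [tau] looks for. *)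
Definition both3 (E : graph) (e : gedge) := (deg E (src e) == 3%N) && (deg E (tgt e) == 3%N).

Lemma both3_side E c d : both3 E (side c d) =
  (deg E (corner c d) == 3%N) && (deg E (corner c (rturn d)) == 3%N).
Proof.
rewrite /both3; case: c d => x y [[] []]; [rewrite andbC| | |rewrite andbC];
  by congr ((deg E _ == _) && (deg E _ == _)); coords; congr pair; lia.
Qed.

Section Kinks.
Variables (E : graph) (cs : seq cell).
Hypothesis chainE : polyomino_chain E cs.
Local Notation n := (size cs).
Local Notation C := (sq cs).
Local Notation h := (heading cs).

Lemma turning_bound i : turning cs i -> (0 < i)%N /\ (i.+1 < n)%N.
Proof. by case/orP => /and3P[]. Qed.

Lemma count_adjacent i : (i < n)%N -> count (adjacent (C i)) cs = ((0 < i) + (i.+1 < n))%N.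
Proof.
move=> iltn; rewrite -[X in count _ X](mkseq_nth (0, 0)) count_map.
have adjE : {in iota 0 n, preim (nth (0, 0) cs) (adjacent (C i)) =1
    predU (pred1 i.+1) (fun j => i == j.+1)}.
  by move=> j; rewrite mem_iota /= => jn; case: chainE => _ _ _ ->.
rewrite (eq_in_count adjE) addnC; set a1 := pred1 _; set a2 := fun _ => _.
have -> : count (predU a1 a2) (iota 0 n) = (count a1 (iota 0 n) + count a2 (iota 0 n))%N.
  rewrite -count_predUI; have -> : count (predI a1 a2) (iota 0 n) = 0%N; last by rewrite addn0.
  transitivity (count pred0 (iota 0 n)); last exact: count_pred0.
  by apply: eq_count => j /=; rewrite /a2 /a1 /=; lia.
congr addn; first by rewrite count_uniq_mem ?iota_uniq // mem_iota.
case: i iltn @a1 @a2 adjE => [|i] iltn a1 a2 _.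
  transitivity (count pred0 (iota 0 n)); last exact: count_pred0.
  exact: eq_count.
rewrite (eq_count (a2 := pred1 i)) => [|j]; last by rewrite /a2 /= eqSS eq_sym.
by rewrite count_uniq_mem ?iota_uniq // mem_iota /= ltnW.
Qed.

Lemma nonterminal_sq i : (i < n)%N -> nonterminal cs (C i) = (0 < i)%N && (i.+1 < n)%N.
Proof.
move=> iltn; rewrite /nonterminal sq_in // count_adjacent //.
by case: (0 < i)%N (i.+1 < n)%N => [] [].
Qed.

Lemma corner_lturn_prev i : (i.+1 < n)%N -> corner (C i.+1) (lturn (h i)) = corner (C i) (h i).
Proof. by move=> i1; rewrite -rturn_back corner_rturn (sq_move chainE) // moveK backK. Qed.

Lemma corner_back_prev i : (i.+1 < n)%N ->
  corner (C i.+1) (back (h i)) = corner (C i) (rturn (h i)).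
Proof. by move=> i1; rewrite corner_rturn (sq_move chainE). Qed.

(** Only a kink has a corner of degree 2 among the non-terminal squares: the corners
    of a straight square are ends of the two sides which it shares. *)
Lemma kink_turning i : (i < n)%N -> kink E cs (C i) = turning cs i.
Proof.
move=> iltn; rewrite /kink nonterminal_sq //; apply/andP/idP => [[/andP[i0 i1]]|].
  move=> /hasP[v]; rewrite mem_corners => /existsP[d /eqP->] /eqP deg2.
  case: i i0 i1 iltn deg2 => // i _ i2 i1 deg2; apply: contraT => nt.
  have eqh : h i.+1 = h i by apply/eqP; move: nt; rewrite (turningE chainE) // negbK.
  have: [|| d == h i, d == lturn (h i), d == back (h i) | d == rturn (h i)].
    by case: d (h i) {deg2 eqh nt} => [[] []] [[] []].
  case/or4P => /eqP eqd; move: deg2; rewrite eqd ?corner_lturn_prev ?corner_back_prev //.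
  - by rewrite -eqh (deg_left chainE).
  - by rewrite (deg_left chainE).
  - by rewrite (deg_right chainE).
  - by rewrite -eqh (deg_right chainE).
move=> ti; split; first by apply/andP; apply: turning_bound.
case/orP: ti => t; [have deg2 := deg_outer_left chainE t|have deg2 := deg_outer_right chainE t];
  (apply/hasP; eexists; last by apply/eqP; exact: deg2);
  by rewrite mem_corners; apply/existsP; eexists.
Qed.

Lemma kink_free : (forall c, ~~ kink E cs c) <-> (forall i, ~~ turning cs i).
Proof.
split=> [nk i|nt c].
  by apply/negP => ti; have [_ /ltnW i1] := turning_bound ti; have := nk (C i); rewrite kink_turning ?ti.
apply/negP => kc; have /andP[/andP[/(nthP (0, 0))[i it eqc] _] _] := kc.
by have := nt i; rewrite -kink_turning // /sq eqc kc.
Qed.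

(** Each side of a kink contains its outer corner, of degree 2, or its inner
    corner, of degree 4. *)
Lemma kink_no_both3 i : turning cs i -> has (both3 E) (sides (C i)) = false.
Proof.
move=> ti; have [i0 i1] := turning_bound ti.
rewrite (has_sides _ _ (h i.-1)) !both3_side lturnK rturn_back rturn_rturn.
case: i i0 i1 ti => // i _ i1 /orP[] t; have /and3P[_ _ /eqP eqh] := t.
  rewrite (deg_outer_left chainE t) /= -eqh (deg_left chainE) // t /= andbF.
  by rewrite !andbF.
rewrite (deg_outer_right chainE t) /= -rturn_rturn -eqh (deg_right chainE) // t /=.
by rewrite !andbF.
Qed.

(** The kinks before and after a straight square turn around one end each of its two
    shared sides.  If these two ends lie on the same side of the chain, the two
    remaining corners are adjacent and of degree 3; otherwise every side has an end
    of degree 4. *)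
Lemma middle_both3 i : turning cs i -> ~~ turning cs i.+1 -> turning cs i.+2 ->
  has (both3 E) (sides (C i.+1)) = same_side cs i.
Proof.
move=> t0 nt1 t2; have [_ i3] := turning_bound t2; have i2 := ltnW i3; have i1 := ltnW i2.
have eqh : h i.+1 = h i by apply/eqP; move: nt1; rewrite (turningE chainE) // negbK.
rewrite /same_side nt1.
rewrite (has_sides _ _ (h i)) !both3_side lturnK rturn_back rturn_rturn.
rewrite corner_lturn_prev ?corner_back_prev //.
have dL' := deg_left chainE i2; have dR' := deg_right chainE i2; rewrite eqh in dL' dR'.
rewrite (deg_left chainE i1) (deg_right chainE i1) dL' dR'.
move: nt1 t0 t2; rewrite /turning.
have := turns_exclusive cs i; have := turns_exclusive cs i.+2.
by case: (left_turn _ i) (left_turn _ i.+1) (left_turn _ i.+2) (right_turn _ i)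
  (right_turn _ i.+1) (right_turn _ i.+2) => [] [] [] [] [] [].
Qed.

End Kinks.

(** * Segments as blocks between consecutive kinks *)

Definition block (cs : seq cell) (a b : nat) : seq cell := take (b - a).+1 (drop a cs).

(** The ends of the block may be kinks of the chain: they are terminal squares of the
    block. *)
Definition straight (cs : seq cell) (a b : nat) : Prop :=
  forall i, (a < i < b)%N -> ~~ turning cs i.

Lemma size_block cs a b : (a <= b < size cs)%N -> size (block cs a b) = (b - a).+1.
Proof. by move=> ab; rewrite size_takel // size_drop; lia. Qed.

Lemma sq_block cs a b i : (a <= b < size cs)%N -> (i < (b - a).+1)%N ->
  sq (block cs a b) i = sq cs (a + i).
Proof. by move=> ab i1; rewrite /sq nth_take // nth_drop. Qed.

Lemma block_fits cs a b : (a <= b < size cs)%N -> (a + size (block cs a b) <= size cs)%N.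
Proof. by move=> ab; rewrite size_block //; lia. Qed.

Lemma block_infix cs a b : infix (block cs a b) cs.
Proof.
by apply: infix_trans (infix_take _ _) (infix_drop _ _).
Qed.

Lemma block_eq cs t a : (a + size t <= size cs)%N -> (0 < size t)%N ->
  (forall i, (i < size t)%N -> sq t i = sq cs (a + i)) ->
  t = block cs a (a + (size t).-1).
Proof.
move=> fits t0 tsq; have ab : (a <= a + (size t).-1 < size cs)%N by lia.
apply: (@eq_from_nth _ (0, 0)) => [|i it].
  by rewrite size_block // addKn prednK.
have {}it : (i < size t)%N := it.
by rewrite -[LHS]/(sq t i) tsq // -[RHS]/(sq _ i) sq_block // addKn prednK.
Qed.

Section Segments.
Variables (E : graph) (cs : seq cell).
Hypothesis chainE : polyomino_chain E cs.
Local Notation n := (size cs).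
Local Notation C := (sq cs).
Local Notation h := (heading cs).

Lemma heading_block a b i : (a <= b < n)%N -> (i < b - a)%N ->
  heading (block cs a b) i = h (a + i).
Proof. by move=> ab ib; rewrite /heading !sq_block //; [rewrite addnS|lia]. Qed.

Lemma turning_block a b i : (a <= b < n)%N -> turning (block cs a b) i =
  [&& (0 < i)%N, (a + i < b)%N & turning cs (a + i)].
Proof.
move=> ab; rewrite /turning /left_turn /right_turn size_block //.
case: i => [//|i] /=; rewrite addnS /=.
have [ib|] := boolP (i.+2 < (b - a).+1)%N; last first.
  by move=> nib /=; rewrite (_ : (_ < b)%N = false) //; lia.
have ib1 : (i.+1 < b - a)%N by lia.
rewrite !heading_block ?(ltnW ib1) // addnS.
have -> : ((a + i).+2 < n)%N by lia.
by have -> : ((a + i).+1 < b)%N by lia.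
Qed.

(** Only the inner squares of a block keep both their neighbours, hence their turns. *)
Lemma linear_subchainE (t : seq cell) : linear_subchain cs t <->
  exists a b, [/\ (a <= b < n)%N, t = block cs a b & straight cs a b].
Proof.
split=> [[t_infix [chain_t no_kink]]|[a [b [ab -> str]]]].
  have [a fits tsq] := infix_sq t_infix.
  have t0 : (0 < size t)%N.
    case: (t) chain_t => // -[[[cardV _ _] _] _ _ _].
    suff V0 : vertices (graph_of [::]) = fset0 by rewrite V0 cardfs0 in cardV.
    by apply/fsetP => v; rewrite in_fset0; apply/negP => /in_vertices[e]; rewrite in_fset.
  have eqt := block_eq fits t0 tsq; set b := (a + _)%N in eqt.
  have ab : (a <= b < n)%N by rewrite /b; lia.
  exists a, b; split=> // i /andP[ai ib]; have := (kink_free chain_t).1 no_kink (i - a)%N.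
  rewrite eqt turning_block // subnKC; last lia.
  by rewrite subn_gt0 ai ib.
split; first exact: block_infix.
have chain_t : polyomino_chain (graph_of (block cs a b)) (block cs a b).
  apply: (@block_chain _ _ chainE _ a); first exact: block_fits.
    by move=> i; rewrite size_block // => ib; apply: sq_block.
  by rewrite -size_eq0 size_block.
split=> //; apply/(kink_free chain_t) => i; rewrite turning_block //.
by apply/negP => /and3P[i0 ib]; apply/negP/str; lia.
Qed.

Lemma block_first a b : (a <= b < n)%N -> head (0, 0) (block cs a b) = C a.
Proof. by move=> ab; rewrite -nth0 -[LHS]/(sq _ 0) sq_block ?addn0. Qed.

Lemma block_infix_bounds a b a' b' : (a <= b < n)%N -> (a' <= b' < n)%N ->
  infix (block cs a b) (block cs a' b') -> (a' <= a)%N /\ (b <= b')%N.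
Proof.
move=> ab ab' inf.
have inb j : (a <= j <= b)%N -> (a' <= j <= b')%N.
  move=> jb; have jn : (j < n)%N by lia.
  have := sq_in_block chainE (block_fits ab) _ jn; rewrite size_block // => H.
  have := sq_in_block chainE (block_fits ab') _ jn; rewrite size_block // => H'.
  have jin : C j \in block cs a b.
    by rewrite H; [lia|move=> i; apply: sq_block].
  have := mem_infix inf jin; rewrite H'; [lia|move=> i; exact: sq_block].
by have := inb a; have := inb b; lia.
Qed.

Lemma block_extend a b a' b' : (a' <= a)%N -> (b <= b')%N -> (a <= b)%N -> (b' < n)%N ->
  infix (block cs a b) (block cs a' b').
Proof.
move=> aa bb ab b'n; have ab' : (a' <= b' < n)%N by lia.
have abn : (a <= b < n)%N by lia.
have -> : block cs a b = block (block cs a' b') (a - a') (a - a' + (size (block cs a b)).-1).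
  apply: block_eq; rewrite ?size_block //; first lia.
  by move=> i ib; rewrite !sq_block //; [congr sq; lia|lia].
exact: block_infix.
Qed.

Definition spans (a b : nat) : Prop :=
  [/\ (a < b < n)%N, straight cs a b, (a == 0%N) || turning cs a & (b.+1 == n) || turning cs b].

(** A block without turns strictly inside can be extended beyond an end unless the
    chain turns or stops there; a block of one square can always be extended. *)
Lemma segmentE t : (1 < n)%N -> segment cs t <-> exists a b, t = block cs a b /\ spans a b.
Proof.
move=> n1; split=> [[/linear_subchainE[a [b [ab -> str]]] maxi]|[a [b [-> [ab str ha hb]]]]].
  have max' a' b' : (a' <= a)%N -> (b <= b')%N -> (b' < n)%N -> straight cs a' b' ->
      a' = a /\ b' = b.
    move=> aa bb bn str'; have ab' : (a' <= b' < n)%N by lia.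
    have inf : infix (block cs a b) (block cs a' b') by apply: block_extend => //; lia.
    have /maxi/(_ inf) eqb : linear_subchain cs (block cs a' b').
      by apply/linear_subchainE; exists a', b'.
    by have := block_infix_bounds ab' ab; rewrite eqb infix_refl => /(_ isT); lia.
  have ltab : (a < b)%N.
    rewrite ltnNge; apply/negP => ba; have {}ba : b = a by lia.
    case: (posnP a) => [a0|a0].
      have [|||i|_] := max' 0%N 1%N; [lia|lia|lia|lia|lia].
    have [|||i|] := max' a.-1 b; [lia|lia|lia|lia|lia].
  exists a, b; split=> //; split=> //; first lia.
    apply/norP => -[a0 nta]; have [|||i ib|] := max' a.-1 b; [lia|lia|lia| |lia].
    by have [->//|ia] := eqVneq i a; apply: str; lia.
  apply/norP => -[bn ntb]; have [|||i ib|] := max' a b.+1; [lia|lia|lia| |lia].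
  by have [->//|ia] := eqVneq i b; apply: str; lia.
split; first by apply/linear_subchainE; exists a, b; split=> //; lia.
move=> t' /linear_subchainE[a' [b' [ab' -> str']]] inf.
have ab0 : (a <= b < n)%N by lia.
have [aa bb] := block_infix_bounds ab0 ab' inf.
have -> : a' = a.
  apply/eqP; rewrite eqn_leq aa leqNgt; apply/negP => ltaa.
  case/orP: ha => [/eqP a0|ta]; first lia.
  by apply: (negP (str' a _)) ta; lia.
have -> // : b' = b.
apply/eqP; rewrite eqn_leq bb andbT leqNgt; apply/negP => ltbb.
case/orP: hb => [/eqP b0|tb]; first lia.
by apply: (negP (str' b _)) tb; lia.
Qed.

(** The right end is the first position after [a] at which the chain turns or stops. *)
Lemma spans_uniq a b b' : spans a b -> spans a b' -> b = b'.
Proof.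
move=> [ab str _ hb] [ab' str' _ hb']; have [ltb|gtb|//] := ltngtP b b'.
  case/orP: hb => [/eqP b0|tb]; first lia.
  by case: (negP (str' b _)) => //; lia.
case/orP: hb' => [/eqP b0|tb]; first lia.
by case: (negP (str b' _)) => //; lia.
Qed.

Definition kinks : seq nat := [seq i <- iota 0 n | turning cs i].

(** Consecutive segments share a kink, so this list gives both the left and, shifted
    by one, the right ends of the segments. *)
Definition cuts : seq nat := 0%N :: rcons kinks n.-1.
Definition cut (i : nat) : nat := nth 0%N cuts i.
Arguments cut : simpl never.

Lemma mem_kinks i : (i \in kinks) = turning cs i.
Proof.
rewrite mem_filter mem_iota /=; case: (boolP (turning cs i)) => //= /turning_bound[_].
by move/ltnW.
Qed.

Lemma sorted_kinks : sorted ltn kinks.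
Proof. by apply: sorted_filter; [apply: ltn_trans|apply: iota_ltn_sorted]. Qed.

Lemma sorted_starts : sorted ltn (0%N :: kinks).
Proof.
rewrite /= path_min_sorted ?sorted_kinks //; apply/allP => i.
by rewrite mem_kinks => /turning_bound[].
Qed.

Lemma size_cuts : size cuts = (size kinks).+2.
Proof. by rewrite /= size_rcons. Qed.

Lemma sorted_cuts : (1 < n)%N -> sorted ltn cuts.
Proof.
move=> n1; rewrite /cuts /= rcons_path; apply/andP; split; first exact: sorted_starts.
have := mem_last 0%N kinks; rewrite inE => /orP[/eqP->|]; first by rewrite /=; lia.
by rewrite mem_kinks /= => /turning_bound; lia.
Qed.

Lemma cuts_lt i j : (1 < n)%N -> (i < j)%N -> (j < size cuts)%N ->
  (cut i < cut j)%N.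
Proof.
move=> n1 ij jc; apply: (sorted_ltn_nth ltn_trans 0%N (sorted_cuts n1)) => //.
by apply: ltn_trans jc.
Qed.

Lemma nth_cuts_start i : (i <= size kinks)%N -> cut i = nth 0%N (0%N :: kinks) i.
Proof. by case: i => //= i ik; rewrite /cut /= nth_rcons ik. Qed.

Lemma cuts_span i : (1 < n)%N -> (i <= size kinks)%N ->
  spans (cut i) (cut i.+1).
Proof.
move=> n1 ik; have lt_i : (cut i < cut i.+1)%N.
  by apply: cuts_lt; rewrite // size_cuts.
have end_i : ((cut i.+1).+1 == n) || turning cs (cut i.+1).
  rewrite -mem_kinks /cut /= nth_rcons; case: ltngtP ik => [lt_ik|//|eq_ik] _.
    by rewrite mem_nth ?orbT.
  by apply/orP; left; lia.
have bn : (cut i.+1 < n)%N.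
  by case/orP: end_i => [/eqP|/turning_bound[]]; lia.
split=> //; first by rewrite lt_i.
- move=> j /andP[aj jb]; apply/negP; rewrite -mem_kinks => jk.
  have jc : j \in cuts by rewrite inE mem_rcons inE jk !orbT.
  have [k kc eqj] := nthP 0%N jc; rewrite -eqj -/(cut k) in aj jb.
  have [ki|ik'] := leqP k i.
    have [eki|ne] := eqVneq k i; first by rewrite eki ltnn in aj.
    have lt_ki : (k < i)%N by lia.
    have ic : (i < size cuts)%N by rewrite size_cuts; lia.
    by have := ltn_trans aj (cuts_lt n1 lt_ki ic); rewrite ltnn.
  have [eki|ne] := eqVneq k i.+1; first by rewrite eki ltnn in jb.
  have lt_ik : (i.+1 < k)%N by lia.
  by have := ltn_trans jb (cuts_lt n1 lt_ik kc); rewrite ltnn.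
- rewrite nth_cuts_start //; case: i ik {lt_i end_i bn} => //= i ik.
  by rewrite -mem_kinks mem_nth ?orbT.
Qed.

(** The left ends of the segments are increasing, and they are 0 and the positions of
    the kinks; each left end determines its segment. *)
Lemma segments_cuts S : (1 < n)%N -> segments cs S ->
  size S = (size kinks).+1 /\
  forall i, (i < size S)%N -> nth [::] S i = block cs (cut i) (cut i.+1).
Proof.
move=> n1 [memS sortedS]; set starts := [seq _ | t <- S] in sortedS.
have uniq_cs : uniq cs by case: chainE.
have start_block a b : spans a b -> index (head (0, 0) (block cs a b)) cs = a.
  move=> [ab _ _ _]; rewrite block_first; last lia.
  by case/andP: ab => ltab bn; rewrite index_uniq // (ltn_trans ltab).
have startsE : starts = 0%N :: kinks.
  apply: (irr_sorted_eq ltn_trans ltnn sortedS sorted_starts) => a.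
  apply/mapP/idP => [[t /memS /(segmentE _ n1)[x [y [-> sp]]] ->]|].
    by rewrite start_block // inE mem_kinks; case: sp.
  move=> /(nthP 0%N)[i ik <-]; have {}ik : (i <= size kinks)%N := ik.
  have sp := cuts_span n1 ik; rewrite -nth_cuts_start //.
  exists (block cs (cut i) (cut i.+1)); last by rewrite start_block.
  by apply/memS/segmentE => //; eexists; eexists; split.
have sizeS : size S = (size kinks).+1 by rewrite -(size_map _ S : size starts = _) startsE.
split=> // i iS; have /memS/(segmentE _ n1)[a [b [eqS sp]]] := mem_nth [::] iS.
have ik : (i <= size kinks)%N by rewrite -ltnS -sizeS.
have eqa : a = cut i.
  by rewrite nth_cuts_start // -startsE (nth_map [::]) // eqS start_block.
rewrite eqS eqa; congr block; apply: (@spans_uniq a) => //.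
by rewrite eqa; apply: cuts_span.
Qed.

End Segments.

(** * The structural vectors *)

Arguments cut : simpl never.

Section Vectors.
Variables (E : graph) (cs : seq cell) (S : seq (seq cell)).
Hypothesis chainE : polyomino_chain E cs.
Hypothesis segS : segments cs S.
Hypothesis n_ge3 : (2 < size cs)%N.
Local Notation n := (size cs).
Local Notation C := (sq cs).
Local Notation cut := (cut cs).
Local Notation l := (length_vector S).

Let n1 : (1 < n)%N := ltnW n_ge3.

Lemma size_segments : size S = (size (kinks cs)).+1.
Proof. by case: (segments_cuts chainE n1 segS). Qed.

Lemma nth_segments i : (i < size S)%N -> nth [::] S i = block cs (cut i) (cut i.+1).
Proof. by case: (segments_cuts chainE n1 segS) => _; apply. Qed.

Lemma segment_spans i : (i < size S)%N -> spans cs (cut i) (cut i.+1).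
Proof. by rewrite size_segments; apply: cuts_span. Qed.

Lemma size_segment i : (i < size S)%N -> size (nth [::] S i) = (cut i.+1 - cut i).+1.
Proof.
move=> iS; have [/andP[ab bn] _ _ _] := segment_spans iS.
by rewrite nth_segments // size_block // ltnW.
Qed.

Lemma nth_length_vector i : (i < size S)%N -> nth 0%N l i = (cut i.+1 - cut i).+1.
Proof. by move=> iS; rewrite (nth_map [::]) // size_segment. Qed.

Lemma cut_kink j : (j < size (kinks cs))%N -> turning cs (cut j.+1).
Proof. by move=> jk; rewrite -mem_kinks /cut /cuts /= nth_rcons jk mem_nth. Qed.

Lemma last_cut : cut (size S) = n.-1.
Proof. by rewrite size_segments /cut /cuts /= nth_rcons ltnn eqxx. Qed.

Lemma beta_first : beta l 0 = turning cs 1.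
Proof.
have S0 : (0 < size S)%N by rewrite size_segments.
have sp := segment_spans S0; have [/andP[ab bn] _ _ hb] := sp.
rewrite /beta nth_length_vector // subn0 eqSS; congr nat_of_bool.
apply/eqP/idP => [eqb|t1].
  by move: hb; rewrite eqb => /orP[/eqP b2|//]; move: n_ge3; rewrite -b2.
by apply: (spans_uniq sp); split; rewrite ?t1 ?orbT // => i; lia.
Qed.

Lemma beta_last : beta l (size S).-1 = turning cs n.-2.
Proof.
have S0 : ((size S).-1 < size S)%N by rewrite size_segments.
have [/andP[ab bn] str ha _] := segment_spans S0.
rewrite /beta nth_length_vector //; congr nat_of_bool.
have eqb : cut (size S).-1.+1 = n.-1 by rewrite prednK ?last_cut // size_segments.
rewrite eqb in ab bn str *; set a := cut _ in ab str ha *.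
apply/eqP/idP => [eqa|t1].
  have {}eqa : a = n.-2 by lia.
  by case/orP: ha => [/eqP a0|]; [lia|rewrite eqa].
have [la|] := ltnP a n.-2; last lia.
by case: (negP (str n.-2 _)) => //; lia.
Qed.

Lemma span_last_kink i : (i < size S)%N -> internal (size S) i = (0 < i)%N && turning cs (cut i.+1).
Proof.
move=> iS; rewrite /internal; congr andb; apply/idP/idP => [i1|].
  by apply: cut_kink; rewrite size_segments in i1.
apply: contraTT; rewrite -leqNgt => iS'; have -> : i.+1 = size S by lia.
by rewrite last_cut; apply/negP => /turning_bound[]; lia.
Qed.

(** Starting at a kink, the segment has length 2 when the chain turns or stops
    at the next square, and being internal excludes that it stops there.  The last
    segment agrees as well, since no kink follows its left end. *)
Lemma alpha_segment j : (j < size (kinks cs))%N -> alpha l j.+1 = turning cs (cut j.+1).+1.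
Proof.
move=> jk; have jS : (j.+1 < size S)%N by rewrite size_segments.
have sp := segment_spans jS; have [/andP[ab bn] _ ha _] := sp.
rewrite /alpha size_map span_last_kink // nth_length_vector //=; congr nat_of_bool.
apply/andP/idP => [[tb /eqP eqb]|t1].
  by have -> : (cut j.+1).+1 = cut j.+2 by lia.
have <- : (cut j.+1).+1 = cut j.+2; last by split=> //; lia.
apply: spans_uniq sp; split; rewrite ?ha ?t1 ?orbT //; last by move=> i; lia.
by rewrite ltnSn; have [_ /ltnW] := turning_bound t1.
Qed.

(** The end squares of an internal segment are kinks, which have no side joining two
    vertices of degree 3, so its middle square decides. *)
Lemma tau_segment j : (j < size (kinks cs))%N -> tau E S j.+1 = same_side cs (cut j.+1).
Proof.
move=> jk; have jS : (j.+1 < size S)%N by rewrite size_segments.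
have ta := cut_kink jk.
have sp := segment_spans jS; have [/andP[ab bn] str ha _] := sp.
rewrite /tau span_last_kink // size_segment //=; congr nat_of_bool.
have has33 t : has (both3 E) (all_sides t) = has (fun c => has (both3 E) (sides c)) t.
  by elim: t => // c t IH; rewrite (_ : all_sides (c :: t) = sides c ++ all_sides t) // has_cat IH.
rewrite -[X in has X _]/(both3 E) has33 nth_segments //.
have has_block b : (cut j.+1 < b < n)%N -> b = (cut j.+1).+2 -> turning cs b ->
    has (fun c => has (both3 E) (sides c)) (block cs (cut j.+1) b)
      = has (both3 E) (sides (C (cut j.+1).+1)).
  move=> cb eqb tb; have cb' : (cut j.+1 <= b < n)%N by lia.
  have -> : block cs (cut j.+1) b = [:: C (cut j.+1); C (cut j.+1).+1; C b].
    have sz : size (block cs (cut j.+1) b) = 3%N by rewrite size_block // eqb; lia.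
    apply: (@eq_from_nth _ (0, 0)); first by rewrite sz.
    rewrite sz => i i3; rewrite -[LHS]/(sq _ i) sq_block // eqb; last lia.
    by case: i i3 => [|[|[|]]] //= _; rewrite ?addn0 ?addn1 ?addn2.
  have has3 (q : pred cell) x y z : has q [:: x; y; z] = [|| q x, q y | q z] by rewrite /= orbF.
  by rewrite has3 (kink_no_both3 chainE ta) (kink_no_both3 chainE tb) orbF.
apply/and3P/idP => [[tb /eqP eqb]|ss].
  have eqb2 : cut j.+2 = (cut j.+1).+2 by lia.
  have nt : ~~ turning cs (cut j.+1).+1 by apply: str; rewrite eqb2; lia.
  by rewrite has_block ?ab // middle_both3 // -eqb2.
have /andP[nt ss'] := ss.
have t2 : turning cs (cut j.+1).+2.
  by rewrite /turning; case/orP: ss' => /andP[_ ->]; rewrite ?orbT.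
have bn2 := turning_bound t2.
have eqb : (cut j.+1).+2 = cut j.+2.
  apply: spans_uniq sp; split; rewrite ?ha ?t2 ?orbT //; first lia.
  by move=> i ib; have -> : i = (cut j.+1).+1 by lia.
rewrite -eqb; split=> //; first by lia.
by rewrite has_block ?middle_both3 //; lia.
Qed.

Lemma sum_over_kinks (F : nat -> nat) :
  (\sum_(0 <= j < size (kinks cs)) F (cut j.+1) = \sum_(0 <= i < n) turning cs i * F i)%N.
Proof.
rewrite (eq_big_nat _ _ (F2 := fun j => F (nth 0%N (kinks cs) j))) => [|j /andP[_ jk]].
  rewrite -(big_nth 0%N xpredT) /= big_filter big_mkcond /index_iota subn0.
  by apply: eq_bigr => i _; case: ifP => _; rewrite ?mul1n.
by rewrite /cut /cuts /= nth_rcons jk.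
Qed.

Lemma sum_alpha :
  (\sum_(0 <= i < size S) alpha l i = \sum_(0 <= i < n) turning cs i * turning cs i.+1)%N.
Proof.
rewrite size_segments big_nat_recl // -(sum_over_kinks (fun i => turning cs i.+1)).
rewrite [alpha _ 0]/alpha /= add0n; apply: eq_big_nat => j /andP[_ jk].
exact: alpha_segment.
Qed.

Lemma sum_tau :
  (\sum_(0 <= i < size S) tau E S i = \sum_(0 <= i < n) same_side cs i)%N.
Proof.
rewrite size_segments big_nat_recl // [tau _ _ 0]/tau /= add0n.
transitivity (\sum_(0 <= i < n) turning cs i * same_side cs i)%N; last first.
  apply: eq_bigr => i _; rewrite /same_side /turning.
  by case: (left_turn cs i) (right_turn cs i) => [] []; rewrite ?mul1n ?andbF.
rewrite -(sum_over_kinks (same_side cs)); apply: eq_big_nat => j /andP[_ jk].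
exact: tau_segment.
Qed.

Lemma count_segments : size S = (1 + \sum_(0 <= i < n) turning cs i)%N.
Proof.
rewrite size_segments add1n; congr _.+1; rewrite size_filter -sum1_count big_mkcond /index_iota subn0.
by apply: eq_bigr => i _; case: ifP.
Qed.

End Vectors.

Theorem theorem2p3 (R : realType) (theta : nat -> nat -> R)
    (theta_sym : forall a b : nat, theta a b = theta b a)
    (theta_ge0 : forall a b : nat, 0 <= theta a b)
    (E : graph) (cs : seq cell) (S : seq (seq cell)) (n s : nat) (l : seq nat)
    (chainE : polyomino_chain E cs) (size_cs : size cs = n) (n_ge3 : (3 <= n)%N)
    (segS : segments cs S) (size_S : size S = s) (lS : l = length_vector S) :
  TI theta E =
    3 * n%:R * theta 3%N 3%N
    + (2 * theta 2%N 3%N - 6 * theta 3%N 3%N + 4 * theta 3%N 4%N) * s%:R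
    + (2 * theta 2%N 2%N + 2 * theta 2%N 3%N + theta 3%N 3%N
       - 4 * theta 3%N 4%N)
    + (theta 2%N 4%N - theta 2%N 3%N + theta 3%N 3%N - theta 3%N 4%N)
      * ((beta l 0)%:R + (beta l s.-1)%:R)
    + (theta 3%N 3%N - 2 * theta 3%N 4%N + theta 4%N 4%N)
      * (\sum_(0 <= i < s) (tau E S i)%:R)
    + (2 * theta 2%N 4%N - 2 * theta 2%N 3%N + 3 * theta 3%N 3%N
       - 4 * theta 3%N 4%N + theta 4%N 4%N)
      * (\sum_(0 <= i < s) (alpha l i)%:R).
Proof.
subst n s l; rewrite (TI_by_turns theta_sym chainE n_ge3).
rewrite (beta_first chainE segS n_ge3) (beta_last chainE segS n_ge3).
rewrite -!natr_sum (sum_alpha chainE segS n_ge3) (sum_tau chainE segS n_ge3).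
rewrite (count_segments chainE segS n_ge3) natrD !natr_sum.
have -> : \sum_(0 <= i < size cs) (turning cs i * turning cs i.+1)%N%:R
    = \sum_(0 <= i < size cs) (turning cs i)%:R * (turning cs i.+1)%:R :> R.
  by apply: eq_bigr => i _; rewrite natrM.
ring.
Qed.
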